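(* For every nontrivial knot $K$, the spherical mosaic number and the mosaic number satisfy $$sm(K) \le m(K) - 2.$$
   Context: A knot means a tame knot: an embedding of $S^1$ into $S^3$ that is ambient isotopic to a polygonal (equivalently smooth) one. A knot diagram represents $K$ if its knot type (ambient isotopy class, unoriented) is that of $K$. A knot is nontrivial if it is not ambient isotopic to the unknot. Mosaic tiles. The tile set is $\mathcal{T}=\{T_0,\dots,T_{10}\}$; each tile is a unit square with arcs joining midpoints of its sides (sides: left L, right R, top U, bottom D): $T_0$ is empty; $T_1,T_2,T_3,T_4$ contain one arc joining respectively L–D, R–D, R–U, L–U; $T_5$ contains the segment L–R; $T_6$ contains the segment U–D; $T_7$ contains two disjoint arcs L–D and R–U; $T_8$ contains two disjoint arcs R–D and L–U; $T_9$ is a crossing of L–R and U–D with L–R over; $T_{10}$ is a crossing of L–R and U–D with U–D over. The midpoint of a side of a tile is a connection point if it is an endpoint of an arc on that tile. Classical mosaics. A knot $n$-mosaic ($n\ge 1$) is an $n\times n$ planar grid of tiles from $\mathcal{T}$ such that for any side shared by two adjacent tiles its midpoint is a connection point of one tile iff it is a connection point of the other, there are no connection points on the outer boundary of the grid, and the arcs form a single closed curve (going straight through crossings). It is then a knot diagram. The mosaic number $m(K)$ is the smallest $n$ such that $K$ is represented by a knot $n$-mosaic. Spherical mosaics. Let the boundary of the cube $[0,n]^3\subset\mathbb{R}^3$ (a topological $S^2$) have each of its six faces divided into an $n\times n$ grid of unit squares. A spherical $n$-mosaic is a placement of one tile of $\mathcal{T}$ (seen from outside the cube) on each of the $6n^2$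 unit squares such that, for each side shared by two unit squares (including sides lying on edges of the cube), its midpoint is a connection point of one tile iff it is a connection point of the other. It is a spherical knot $n$-mosaic if its arcs form a single closed curve; it is then a knot diagram on $S^2$ and represents a knot. The spherical mosaic number $sm(K)$ is the smallest integer $n\ge1$ such that $K$ is represented by a spherical knot $n$-mosaic. *)

(* Defs.v *)
From HB Require Import structures.
From mathcomp Require Import all_boot all_order all_algebra.
From mathcomp Require Import all_classical all_reals all_analysis.
Set Implicit Arguments.
Unset Strict Implicit.
Unset Printing Implicit Defensive.
Import Order.TTheory GRing.Theory Num.Theory.
Import numFieldNormedType.Exports.
Local Open Scope classical_set_scope.
Local Open Scope ring_scope.

Notation R3 R := (R * R * R)%type.

(* S^3 is R^3 with a point [None] at infinity; [Some] embeds R^3 into it. *)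
Notation S3 R := (one_point_compactification (R * R * R)%type).

Definition in_S3 (R : realType) (A : set (R3 R)) : set (S3 R) := Some @` A.

Definition circle (R : realType) : set (R * R) :=
  [set p | p.1 ^+ 2 + p.2 ^+ 2 = 1].
Arguments circle R : clear implicits.

Definition segment (R : realType) (a b : R3 R) : set (R3 R) :=
  [set (1 - t) *: a + t *: b | t in `[0, 1]%classic].

Definition homeomorphism (X : topologicalType) (f : X -> X) : Prop :=
  continuous f /\
  exists g : X -> X, [/\ continuous g, cancel f g & cancel g f].

Definition is_ambient_isotopy (R : realType) (H : R * S3 R -> S3 R) : Prop :=
  [/\ {within `[0, 1]%classic `*` [set: S3 R], continuous H},
      forall t : R, 0 <= t <= 1 -> homeomorphism (fun x => H (t, x)) &
      forall x : S3 R, H (0, x) = x].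

(* Comparing images, rather than parametrizations, makes knot types
   unoriented. *)
Definition ambient_isotopic (R : realType) (A B : set (S3 R)) : Prop :=
  exists H : R * S3 R -> S3 R,
    is_ambient_isotopy H /\ (fun x => H (1, x)) @` A = B.

Definition polygonal (R : realType) (A : set (S3 R)) : Prop :=
  exists s : seq (R3 R * R3 R),
    A = in_S3 (\bigcup_(e in [set` s]) segment e.1 e.2).

(* A continuous injection of the compact S^1 into the Hausdorff S^3 is an
   embedding. A polygonal set ambient isotopic to the image of a knot is
   homeomorphic to S^1, hence is a simple closed polygon. *)
Record knot (R : realType) : Type := Knot {
  knot_map : R * R -> S3 R;
  knot_continuous : {within circle R, continuous knot_map};
  knot_injective : {in circle R &, injective knot_map};
  knot_tame : exists P : set (S3 R),
    polygonal P /\ ambient_isotopic (knot_map @` circle R) P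
}.

Definition knot_image (R : realType) (K : knot R) : set (S3 R) :=
  knot_map K @` circle R.

Definition unknot_image (R : realType) : set (S3 R) :=
  in_S3 [set v : R3 R | circle R v.1 /\ v.2 = 0].
Arguments unknot_image R : clear implicits.

Definition nontrivial (R : realType) (K : knot R) : Prop :=
  ~ ambient_isotopic (knot_image K) (unknot_image R).

Inductive side := sideL | sideR | sideU | sideD.

Definition side_code (s : side) : 'I_4 :=
  match s with
  | sideL => @Ordinal 4 0 isT | sideR => @Ordinal 4 1 isT | sideU => @Ordinal 4 2 isT | sideD => @Ordinal 4 3 isT
  end.

Definition side_decode (k : 'I_4) : side :=
  match val k with 0%N => sideL | 1%N => sideR | 2%N => sideU | _ => sideD end.

Lemma side_codeK : cancel side_code side_decode.
Proof. by case. Qed.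

HB.instance Definition _ := Finite.copy side (can_type side_codeK).

Inductive tile := T0 | T1 | T2 | T3 | T4 | T5 | T6 | T7 | T8 | T9 | T10.

Definition tile_arcs (T : tile) : seq (side * side) :=
  match T with
  | T0 => [::]
  | T1 => [:: (sideL, sideD)]
  | T2 => [:: (sideR, sideD)]
  | T3 => [:: (sideR, sideU)]
  | T4 => [:: (sideL, sideU)]
  | T5 => [:: (sideL, sideR)]
  | T6 => [:: (sideU, sideD)]
  | T7 => [:: (sideL, sideD); (sideR, sideU)]
  | T8 => [:: (sideR, sideD); (sideL, sideU)]
  | T9 | T10 => [:: (sideL, sideR); (sideU, sideD)]
  end.

Definition over_arc (T : tile) (a : side * side) : bool :=
  match T with
  | T9 => a == (sideL, sideR)
  | T10 => a == (sideU, sideD)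
  | _ => false
  end.

Definition is_connection (T : tile) (s : side) : bool :=
  has (fun a => (s == a.1) || (s == a.2)) (tile_arcs T).

(* A unit square in R^3: a corner, the unit vectors pointing right and up along
   the sides at that corner, and the unit normal pointing to the viewer, with
   (right, up, normal) positively oriented. *)
Record square (R : realType) : Type := Square {
  sq_corner : R3 R;
  sq_right : R3 R;
  sq_up : R3 R;
  sq_normal : R3 R
}.

Definition sq_point (R : realType) (Q : square R) (a b h : R) : R3 R :=
  sq_corner Q + a *: sq_right Q + b *: sq_up Q + h *: sq_normal Q.

Definition midpoint (R : realType) (Q : square R) (s : side) : R3 R :=
  match s with
  | sideL => sq_point Q 0 (1 / 2) 0
  | sideR => sq_point Q 1 (1 / 2) 0
  | sideU => sq_point Q (1 / 2) 1 0
  | sideD => sq_point Q (1 / 2) 0 0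
  end.

(* The point at height 1/2 above the centre of the square, through which the
   over-strand of a crossing passes. *)
Definition apex (R : realType) (Q : square R) : R3 R :=
  sq_point Q (1 / 2) (1 / 2) (1 / 2).

(* Arcs are drawn straight, except that the over-strand of a crossing is lifted
   off the surface, towards the viewer. *)
Definition arc_set (R : realType) (Q : square R) (T : tile)
    (a : side * side) : set (R3 R) :=
  let p := midpoint Q a.1 in
  let q := midpoint Q a.2 in
  if over_arc T a then segment p (apex Q) `|` segment (apex Q) q
  else segment p q.

Section Mosaics.
Variables (R : realType) (I : finType) (sq : I -> square R) (M : I -> tile).

Definition suitably_connected : Prop :=
  forall (p q : I) (s t : side), p != q ->
    midpoint (sq p) s = midpoint (sq q) t ->
    is_connection (M p) s = is_connection (M q) t.

Definition no_boundary_connection : Prop :=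
  forall (p : I) (s : side),
    (forall (q : I) (t : side), q != p ->
       midpoint (sq q) t != midpoint (sq p) s) ->
    ~~ is_connection (M p) s.

Definition is_arc (x : I * (side * side)) : bool := x.2 \in tile_arcs (M x.1).

Definition endpoints (x : I * (side * side)) : seq (R3 R) :=
  [:: midpoint (sq x.1) x.2.1; midpoint (sq x.1) x.2.2].

Definition linked : rel (I * (side * side)) :=
  fun x y => [&& is_arc x, is_arc y & has (mem (endpoints x)) (endpoints y)].

(* In a suitably connected mosaic without boundary connection points every
   endpoint of an arc is an endpoint of exactly one other arc, so each class of
   arcs under [connect linked] is a closed curve; the two arcs of a crossing
   have no common endpoint, so these curves go straight through crossings. *)
Definition single_closed_curve : Prop :=
  (exists x, is_arc x) /\
  (forall x y, is_arc x -> is_arc y -> connect linked x y).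

Definition mosaic_set : set (R3 R) :=
  \bigcup_(x in [set x | is_arc x]) arc_set (sq x.1) (M x.1) x.2.

Definition represents (K : knot R) : Prop :=
  ambient_isotopic (knot_image K) (in_S3 mosaic_set).

End Mosaics.

(* The unit square [i, i+1] x [j, j+1] of the plane z = 0, seen from above. *)
Definition planar_square (R : realType) (n : nat) (p : 'I_n * 'I_n) : square R :=
  Square ((p.1)%:R, (p.2)%:R, 0) (1, 0, 0) (0, 1, 0) (0, 0, 1).

Inductive face := faceX0 | faceX1 | faceY0 | faceY1 | faceZ0 | faceZ1.

Definition face_code (f : face) : 'I_6 :=
  match f with
  | faceX0 => @Ordinal 6 0 isT | faceX1 => @Ordinal 6 1 isT | faceY0 => @Ordinal 6 2 isT
  | faceY1 => @Ordinal 6 3 isT | faceZ0 => @Ordinal 6 4 isT | faceZ1 => @Ordinal 6 5 isT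
  end.

Definition face_decode (k : 'I_6) : face :=
  match val k with
  | 0%N => faceX0 | 1%N => faceX1 | 2%N => faceY0
  | 3%N => faceY1 | 4%N => faceZ0 | _ => faceZ1
  end.

Lemma face_codeK : cancel face_code face_decode.
Proof. by case. Qed.

HB.instance Definition _ := Finite.copy face (can_type face_codeK).

(* The unit squares of the boundary of [0, n]^3, seen from outside: faceX0 lies
   in x = 0, faceX1 in x = n, and so on, and the normals point outwards. The
   choice of the right direction on each face is immaterial, as the set of
   tiles is stable under rotation. *)
Definition cube_square (R : realType) (n : nat) (p : face * ('I_n * 'I_n)) :
    square R :=
  let a : R := (p.2.1)%:R in
  let b : R := (p.2.2)%:R in
  match p.1 with
  | faceX0 => Square (0, b, a) (0, 0, 1) (0, 1, 0) (-1, 0, 0)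
  | faceX1 => Square (n%:R, a, b) (0, 1, 0) (0, 0, 1) (1, 0, 0)
  | faceY0 => Square (a, 0, b) (1, 0, 0) (0, 0, 1) (0, -1, 0)
  | faceY1 => Square (b, n%:R, a) (0, 0, 1) (1, 0, 0) (0, 1, 0)
  | faceZ0 => Square (b, a, 0) (0, 1, 0) (1, 0, 0) (0, 0, -1)
  | faceZ1 => Square (a, b, n%:R) (1, 0, 0) (0, 1, 0) (0, 0, 1)
  end.

Definition knot_mosaic (R : realType) (n : nat) (M : 'I_n * 'I_n -> tile) :
    Prop :=
  [/\ suitably_connected (@planar_square R n) M,
      no_boundary_connection (@planar_square R n) M &
      single_closed_curve (@planar_square R n) M].

Definition spherical_knot_mosaic (R : realType) (n : nat)
    (M : face * ('I_n * 'I_n) -> tile) : Prop :=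
  suitably_connected (@cube_square R n) M /\
  single_closed_curve (@cube_square R n) M.

Definition has_mosaic (R : realType) (K : knot R) (n : nat) : Prop :=
  (1 <= n)%N /\ exists M : 'I_n * 'I_n -> tile,
    knot_mosaic R M /\ represents (@planar_square R n) M K.

Definition has_spherical_mosaic (R : realType) (K : knot R) (n : nat) : Prop :=
  (1 <= n)%N /\ exists M : face * ('I_n * 'I_n) -> tile,
    spherical_knot_mosaic R M /\ represents (@cube_square R n) M K.

Definition is_least (P : nat -> Prop) (n : nat) : Prop :=
  P n /\ forall k : nat, P k -> (n <= k)%N.

Definition is_mosaic_number (R : realType) (K : knot R) (m : nat) : Prop :=
  is_least (has_mosaic K) m.

Definition is_spherical_mosaic_number (R : realType) (K : knot R) (s : nat) :
    Prop :=
  is_least (has_spherical_mosaic K) s.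

(* Main.v *)
Require Import Defs.
From HB Require Import structures.
From mathcomp Require Import all_boot all_order all_algebra.
From mathcomp Require Import all_classical all_reals all_analysis.
From mathcomp Require Import ring lra zify.

(** Let n = m - 2.  The tiles of an m-mosaic split into an inner n x n block and
    a boundary ring one tile wide.  As no connection point lies on the outer
    boundary, a tile of the ring carries at most one arc and no crossing, and a
    corner tile merely joins the two tiles next to it.  Place the inner block on
    the top face of the cube [0,n]^3 and fold the four sides of the ring down onto
    the top rows of the four side faces.  Two consecutive sides of the ring then
    meet along a vertical edge of the cube, so that the corner tiles can be dropped;
    all other squares of the cube remain empty.

    Two things must be checked.  The first is combinatorial: the tiles obtained in
    this way form a spherical knot mosaic ([cube_suitably_connected],
    [cube_single_closed_curve]).  The curve is followed through the map carrying
    the connection points of the planar mosaic to those of the cube; a corner arc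
    has its two ends sent to one point, so removing it does not disconnect anything.

    The second is topological: the two curves are ambient isotopic
    ([planar_cube_isotopic]).  The isotopy is a composition of shifts
    p |-> p + h(p) v in a fixed direction v, with h continuous and bounded.
    Such a shift extends by the identity at infinity, and if it is increasing along
    each line of direction v, then so is p |-> p + t h(p) v for 0 <= t <= 1, which
    gives an ambient isotopy of the three-sphere ([shift_isotopic]).  The first
    shift tilts the plane outside [0,n]^2 downwards, to a depth equal to the
    L1-distance from the square; the corner arcs then lie horizontally at depth 1/2.
    Two further shifts push the tilted sides onto the walls of the cube, first in
    the direction of x, then in the direction of y ([push_side], [push_end],
    [push_corner]).  The sides y = 0 and y = n are then in their final position.  On
    the sides x = 0 and x = n, the image of a corner arc has to be absorbed by the
    last tile of the side.  If that tile is a straight line, this is automatic; if it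
    is a quarter turn, then its image and that of the corner arc form a bent path,
    and a last shift, vertical and depending on the mosaic, straightens that path
    ([straighten_corner]).

    Finally m >= 3: a 1-mosaic has no arc, and the curve of a 2-mosaic is a diamond,
    which is stretched into a round circle by shifts ([diamond_unknot]); hence such
    mosaics do not represent a nontrivial knot. *)

Set Implicit Arguments.
Unset Strict Implicit.
Unset Printing Implicit Defensive.
Import Order.TTheory GRing.Theory Num.Theory.
Import numFieldNormedType.Exports.
Local Open Scope classical_set_scope.
Local Open Scope ring_scope.

(** * Ambient isotopies of the three-sphere *)

Section Isotopy.
Variable R : realType.
Implicit Types (A B C : set (S3 R)) (p q v : R3 R) (h : R3 R -> R).

(** The second isotopy is run on top of the first, at the same time t, rather than after
    it: no reparametrization of [0, 1] is needed. *)
Lemma ambient_isotopic_trans A B C :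
  ambient_isotopic A B -> ambient_isotopic B C -> ambient_isotopic A C.
Proof.
move=> [H [[Hc Hh H0] HB]] [G [[Gc Gh G0] GC]].
exists (fun tx => G (tx.1, H tx)); split; last first.
  by rewrite -GC -HB image_comp.
split.
- apply/subspace_continuousP => -[t x] Atx.
  move/subspace_continuousP: Hc => Hc.
  move/subspace_continuousP: Gc => Gc.
  have Hx := Hc _ Atx.
  have := Gc (t, H (t, x)) (conj Atx.1 I) => Gtx U /Gtx GU.
  rewrite /nbhs /= /within /= in GU *.
  have : (fun tx : R * S3 R => (tx.1, H tx)) @ within (`[0, 1]%classic `*` setT)
      (nbhs (t, x)) --> (t, H (t, x)).
    apply: (cvg_pair (G := nbhs t) (H := nbhs (H (t, x)))) => //.
    apply: cvg_within_filter; exact: (@cvg_fst _ _ (nbhs t) (nbhs x)).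
  move=> /(_ _ GU); rewrite /nbhs /= /within /=.
  apply: filterS => y Ay [y1 _]; exact: (Ay (conj y1 I) (conj y1 I)).
- move=> t t01; have [hc [h' [h'c hK h'K]]] := Hh t t01.
  have [gc [g' [g'c gK g'K]]] := Gh t t01; split.
    by move=> x; apply: continuous_comp (hc x) (gc _).
  exists (h' \o g'); split; first by move=> x; apply: continuous_comp (g'c x) (h'c _).
    by move=> x /=; rewrite gK hK.
  by move=> x /=; rewrite h'K g'K.
- by move=> x; rewrite /= H0 G0.
Qed.

Lemma box_compact (r : R) : compact [set p : R3 R | `|p| <= r].
Proof.
have -> : [set p : R3 R | `|p| <= r] = (`[-r, r] `*` `[-r, r]) `*` `[-r, r].
  apply/seteqP; split => -[[x y] z] /=; rewrite !in_itv /= -!ler_norml.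
    by rewrite /Num.norm /= !ge_max => /andP[/andP[-> ->] ->].
  by case=> -[hx hy] hz; rewrite /Num.norm /= !ge_max hx hy hz.
by apply: compact_setX; [apply: compact_setX|]; exact: segment_compact.
Qed.

Lemma box_closed (r : R) : closed [set p : R3 R | `|p| <= r].
Proof. apply: compact_closed (@box_compact r); exact: norm_hausdorff. Qed.

Lemma nbhs_infty (r : R) :
  nbhs (None : S3 R) (Some @` (~` [set p : R3 R | `|p| <= r]) `|` [set None]).
Proof.
exists [set p : R3 R | `|p| <= r]; last by [].
by split; [exact: box_compact|exact: box_closed].
Qed.

Lemma nbhs_inftyP (U : set (S3 R)) : nbhs (None : S3 R) U ->
  exists r : R, forall p : R3 R, r < `|p| -> U (Some p).
Proof.
case=> K [/compact_bounded[r [_ Kr]] _] KU.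
exists (r + 1) => p rp; apply: KU; left; exists p => //= Kp.
by have := Kr (r + 1); rewrite ltrDl ltr01 => /(_ isT _ Kp) /=; rewrite leNgt rp.
Qed.

(** Closed boxes are compact, so that their complements separate infinity from a point
    of R^3. *)
Lemma S3_hausdorff : hausdorff_space (S3 R).
Proof.
have sep (p : R3 R) : ~ cluster (nbhs (Some p : S3 R)) (None : S3 R).
  move=> /(_ (Some @` [set q : R3 R | `|q| < `|p| + 1]) _ _ (nbhs_infty (`|p| + 1))) [].
    apply: one_point_compactification_some_nbhs.
    apply: open_nbhs_nbhs; split; last by rewrite /= ltrDl.
    apply: (@open_comp _ _ (@Num.norm R _) [set x | x < `|p| + 1]).
      by move=> x _; exact: norm_continuous.
    exact: open_lt.
  move=> x [[q qp <-]] [[q' /= q'p [qq']]|//].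
  by rewrite qq' in q'p; apply: q'p; exact: ltW.
move=> [p|] [q|] //; last 2 first.
- by move=> /sep.
- by move=> c; exfalso; apply: (sep q) => A B hA hB; have [z [? ?]] := c _ _ hB hA; exists z.
move=> c; congr Some; apply: (@norm_hausdorff _ (R3 R)) => A B hA hB.
have [_ [[x Ax <-] [y By [yx]]]] := c _ _
  (@one_point_compactification_some_nbhs _ p A hA)
  (@one_point_compactification_some_nbhs _ q B hB).
by exists x; split => //; rewrite -yx.
Qed.

Definition extend_infty (f : R3 R -> R3 R) : S3 R -> S3 R := omap f.

(** At infinity continuity comes from the bound on the displacement: the preimage of the
    outside of a box contains the outside of a box larger by C, for all values of the
    parameter at once. *)
Lemma extend_infty_continuous (T : topologicalType) (f : T * R3 R -> R3 R) (C : R) :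
  continuous f -> (forall tp, `|f tp - tp.2| <= C) ->
  continuous (fun tx : T * S3 R => extend_infty (fun p => f (tx.1, p)) tx.2).
Proof.
move=> fc fC [t [p|]] U /= hU.
  have [/= [A B] [/= hA hB] ABU] := fc (t, p) _ hU.
  exists (A, Some @` B) => /=.
    by split=> //; exact: one_point_compactification_some_nbhs.
  by move=> [s _] /= [As [q Bq <-]]; exact: (ABU (s, q)).
have [r hr] := nbhs_inftyP hU.
exists (setT, (Some @` (~` [set p : R3 R | `|p| <= r + C]) `|` [set None])) => /=.
  by split; [exact: filterT|exact: nbhs_infty].
move=> [s x] /= [_ [[q /= + <-]|->]] /=; last exact: nbhs_singleton hU.
move/negP; rewrite -ltNge => rq; apply: hr.
have := fC (s, q) => /= fq; have := ler_distD (f (s, q)) q 0.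
rewrite !subr0 distrC; lra.
Qed.

(** The three-sphere is compact and Hausdorff, so that a continuous bijection is closed. *)
Lemma bijective_homeomorphism (f : S3 R -> S3 R) :
  continuous f -> bijective f -> homeomorphism f.
Proof.
move=> fc [g fK gK]; split=> //; exists g; split=> //.
apply/continuous_closedP => A cA.
have -> : g @^-1` A = f @` A.
  apply/seteqP; split=> x; first by move=> /= Ax; exists (g x).
  by move=> [y Ay <-]; rewrite /= fK.
apply: (compact_closed S3_hausdorff); apply: continuous_compact.
  exact: continuous_subspaceT.
by apply: subclosed_compact cA one_point_compactification_compact _.
Qed.

Lemma isotopy_of_displacement (f : R * R3 R -> R3 R) (C : R) (A : set (R3 R)) :
  continuous f -> (forall tp, `|f tp - tp.2| <= C) ->
  (forall t, bijective (fun p => f (t, p))) -> (forall p, f (0, p) = p) ->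
  ambient_isotopic (in_S3 A) (in_S3 ((fun p => f (1, p)) @` A)).
Proof.
move=> fc fC fb f0.
have fext := extend_infty_continuous fc fC.
exists (fun tx => extend_infty (fun p => f (tx.1, p)) tx.2); split; last first.
  by rewrite /in_S3 !image_comp.
split=> [|t _|[p|] //=]; last by rewrite f0.
  exact: continuous_subspaceT.
apply: bijective_homeomorphism.
  move=> x U /(fext (t, x)) [[V W] /= [Vt Wx] VWU]; apply: filterS Wx => y Wy.
  by apply: (VWU (t, y)); split=> //; exact: nbhs_singleton Vt.
have [g fK gK] := fb t; exists (omap g) => -[p|] //=; first by rewrite fK.
by rewrite gK.
Qed.

(** The map tested for monotonicity is s |-> s + h(p + s v); the corresponding map for t
    h is its convex combination with the identity, hence is increasing as well.
    Injectivity follows, and the intermediate value theorem on [-C, C] gives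
    surjectivity. *)
Lemma shift_isotopic (h : R3 R -> R) v (C : R) (A : set (R3 R)) :
  continuous h -> (forall p, `|h p| <= C) ->
  (forall p (s : R), 0 < s -> h p < s + h (p + s *: v)) ->
  ambient_isotopic (in_S3 A) (in_S3 ((fun p => p + h p *: v) @` A)).
Proof.
move=> hc hC hv.
(* Truncating the time makes the displacement bounded uniformly for all real times. *)
pose cl (t : R) := Num.max 0 (Num.min 1 t).
have cl01 t : 0 <= cl t <= 1.
  by rewrite /cl; apply/andP; split; [rewrite le_max lexx|rewrite ge_max ler01 ge_min lexx].
have cl_c : continuous cl.
  move=> t; apply: continuous_max; first exact: cvg_cst.
  by apply: continuous_min; [exact: cvg_cst|exact: cvg_id].
have C0 : 0 <= C by apply: le_trans (hC 0).
pose f tp := tp.2 + (cl tp.1 * h tp.2) *: v.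
have -> : (fun p => p + h p *: v) = (fun p => f (1, p)).
  by apply/funext => p; rewrite /f /cl /= minxx max_r ?ler01// mul1r.
apply: (isotopy_of_displacement (C := C * `|v|)).
- move=> x; apply: cvgD; first exact: cvg_snd.
  apply: cvgZr_tmp; apply: cvgM.
    by apply: continuous_comp (cl_c _); exact: cvg_fst.
  by apply: continuous_comp (hc _); exact: cvg_snd.
- move=> tp; rewrite /f addrC addKr normrZ normrM.
  have /andP[c0 c1] := cl01 tp.1; rewrite ger0_norm//.
  apply: ler_wpM2r => //; apply: le_trans (hC tp.2).
  by rewrite ler_piMl.
- move=> t; have /andP[c0 c1] := cl01 t.
  have mono p (s : R) : 0 < s -> cl t * h p < s + cl t * h (p + s *: v).
    move=> s0; have hs := hv p _ s0.
    have [c1'|c1'] := ltP (cl t) 1.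
      have : 0 < (1 - cl t) * s by rewrite mulr_gt0 // subr_gt0.
      have : 0 <= cl t * (s + h (p + s *: v) - h p) by rewrite mulr_ge0 // subr_ge0 ltW.
      lra.
    have -> : cl t = 1 by apply/le_anti/andP.
    by rewrite !mul1r.
  have inj : injective (fun p => f (t, p)).
    move=> p q; rewrite /f /= => e.
    wlog st : p q e / cl t * h p <= cl t * h q.
      by move=> W; case/orP: (le_total (cl t * h p) (cl t * h q)) => [/W|/W W'];
        [exact|exact/esym/W'].
    have pq : p = q + (cl t * h q - cl t * h p) *: v.
      by rewrite scalerBl addrA -e addrK.
    move: st; rewrite le_eqVlt => /predU1P[st|]; first by rewrite pq st subrr scale0r addr0.
    by rewrite -subr_gt0 => /(mono q); rewrite -pq subrK ltxx.
  have surj q : exists p, f (t, p) = q.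
    pose u (s : R) := s + cl t * h (q + s *: v).
    have uc : continuous u.
      move=> s; apply: cvgD; first exact: cvg_id.
      apply: cvgM; first exact: cvg_cst.
      apply: (@cvg_comp _ _ _ (fun s => q + s *: v) h _ (nbhs (q + s *: v))); last exact: hc.
      by apply: cvgD; [exact: cvg_cst|apply: cvgZr_tmp; exact: cvg_id].
    have ub s : `|cl t * h (q + s *: v)| <= C.
      by rewrite normrM ger0_norm //; apply: le_trans (hC (q + s *: v)); rewrite ler_piMl.
    have [] := @IVT R u (- C) C 0 _ (continuous_subspaceT uc).
    + lra.
    + have := ub C; have := ub (- C);
        rewrite !ler_norml /u ge_min le_max => /andP[? ?] /andP[? ?].
      by apply/andP; split; apply/orP; [left|right]; lra.
    + move=> s _ us; exists (q + s *: v).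
      by rewrite /f /= -addrA -scalerDl -/(u s) us scale0r addr0.
  have [g fg] := choice surj.
  by exists g => // p; apply: inj; rewrite fg.
- by move=> p; rewrite /f /cl /= min_r ?ler01// maxxx mul0r scale0r addr0.
Qed.
End Isotopy.

(** * Shifts along the coordinate axes *)

Lemma cont_fst (T U V : topologicalType) (f : T -> U * V) :
  continuous f -> continuous (fun p => (f p).1).
Proof. by move=> fc p; apply: (cvg_comp _ _ (fc p)); exact: cvg_fst. Qed.
Lemma cont_snd (T U V : topologicalType) (f : T -> U * V) :
  continuous f -> continuous (fun p => (f p).2).
Proof. by move=> fc p; apply: (cvg_comp _ _ (fc p)); exact: cvg_snd. Qed.

Section Cont.
Variables (R : realType) (T : topologicalType).
Implicit Types f g : T -> R.
Lemma contD f g : continuous f -> continuous g -> continuous (fun p => f p + g p).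
Proof. by move=> fc gc p; apply: cvgD; [exact: fc|exact: gc]. Qed.
Lemma contN f : continuous f -> continuous (fun p => - f p).
Proof. by move=> fc p; apply: cvgN; exact: fc. Qed.
Lemma contM f g : continuous f -> continuous g -> continuous (fun p => f p * g p).
Proof. by move=> fc gc p; apply: cvgM; [exact: fc|exact: gc]. Qed.
Lemma cont_max f g : continuous f -> continuous g ->
  continuous (fun p => Num.max (f p) (g p)).
Proof. by move=> fc gc p; apply: (@continuous_max _ _ f g p); [exact: fc|exact: gc]. Qed.
Lemma cont_min f g : continuous f -> continuous g ->
  continuous (fun p => Num.min (f p) (g p)).
Proof. by move=> fc gc p; apply: (@continuous_min _ _ f g p); [exact: fc|exact: gc]. Qed.
Lemma cont_norm f : continuous f -> continuous (fun p => `|f p|).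
Proof. by move=> fc p; apply: cvg_norm; exact: fc. Qed.
Lemma cont_sqrt f : continuous f -> continuous (fun p => Num.sqrt (f p)).
Proof. by move=> fc p; apply: (@cvg_comp _ _ _ f Num.sqrt _ (nbhs (f p)));
  [exact: fc|exact: sqrt_continuous]. Qed.
Lemma cont_cst (c : R) : continuous (fun _ : T => c).
Proof. by move=> p; exact: cvg_cst. Qed.
End Cont.
Lemma cont_id (T : topologicalType) : continuous (fun p : T => p).
Proof. by move=> p; exact: cvg_id. Qed.

Ltac continuity := lazymatch goal with
  | |- continuous (fun p => Order.max (@?f p) (@?g p)) => refine (@cont_max _ _ f g _ _);
    continuity
  | |- continuous (fun p => Order.min (@?f p) (@?g p)) => refine (@cont_min _ _ f g _ _);
    continuity
  | |- continuous (fun p => Num.norm (@?f p)) => refine (@cont_norm _ _ f _); continuity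
  | |- continuous (fun p => Num.sqrt (@?f p)) => refine (@cont_sqrt _ _ f _); continuity
  | |- continuous (fun p => @?f p + @?g p) => refine (@contD _ _ f g _ _); continuity
  | |- continuous (fun p => @?f p * @?g p) => refine (@contM _ _ f g _ _); continuity
  | |- continuous (fun p => (@?f p) ^+ 2) => refine (@contM _ _ f f _ _); continuity
  | |- continuous (fun p => - @?f p) => refine (@contN _ _ f _); continuity
  | |- continuous (fun p => (@?f p).1) => refine (@cont_fst _ _ _ f _); continuity
  | |- continuous (fun p => (@?f p).2) => refine (@cont_snd _ _ _ f _); continuity
  | |- continuous (fun p => p) => exact: cont_id
  | |- _ => exact: cont_cst
  end.

(** Innermost terms are treated first, so that the comparisons that are introduced are
    linear and can be used to discard impossible branches at once. *)
Ltac minmax_free a := lazymatch a with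
  | context [Order.max _ _] => fail | context [Order.min _ _] => fail
  | context [Num.norm _] => fail | _ => idtac end.
Ltac minmax_step := match goal with
  | |- context [Order.max ?a ?b] => minmax_free a; minmax_free b; case: (leP a b) => ?
  | |- context [Order.min ?a ?b] => minmax_free a; minmax_free b; case: (leP a b) => ?
  | |- context [Num.norm ?a] => minmax_free a; case: (ger0P a) => ?
  end.
Ltac minmax := repeat (minmax_step; try lra); try lra.

Lemma le_or_lt (R : realType) (x y : R) : x <= y \/ y < x.
Proof. by case: (leP x y); [left|right]. Qed.

Section Shift.
Variable R : realType.
Implicit Types (A : set (R3 R)) (h : R3 R -> R) (C : R).

Lemma add_scale_x (x y z s : R) : (x, y, z) + s *: (1, 0, 0) = (x + s, y, z) :> R3 R.
Proof. by rewrite -[LHS]/(x + s * 1, y + s * 0, z + s * 0) mulr1 mulr0 !addr0. Qed.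
Lemma add_scale_y (x y z s : R) : (x, y, z) + s *: (0, 1, 0) = (x, y + s, z) :> R3 R.
Proof. by rewrite -[LHS]/(x + s * 0, y + s * 1, z + s * 0) mulr1 mulr0 !addr0. Qed.
Lemma add_scale_z (x y z s : R) : (x, y, z) + s *: (0, 0, 1) = (x, y, z + s) :> R3 R.
Proof. by rewrite -[LHS]/(x + s * 0, y + s * 0, z + s * 1) mulr1 mulr0 !addr0. Qed.

Lemma shift_x_isotopic h C A : continuous h -> (forall p, `|h p| <= C) ->
  (forall x x' y z, x < x' -> x + h (x, y, z) < x' + h (x', y, z)) ->
  ambient_isotopic (in_S3 A) (in_S3 ((fun p => (p.1.1 + h p, p.1.2, p.2)) @` A)).
Proof.
move=> hc hC hm; rewrite (_ : (fun p => _) = (fun p => p + h p *: (1, 0, 0))).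
  apply: (shift_isotopic A hc hC) => -[[x y] z] s s0; rewrite add_scale_x.
  by have := hm x (x + s) y z; rewrite ltrDl -addrA ltrD2l; exact.
by apply/funext => -[[x y] z]; rewrite add_scale_x.
Qed.

Lemma shift_y_isotopic h C A : continuous h -> (forall p, `|h p| <= C) ->
  (forall x y y' z, y < y' -> y + h (x, y, z) < y' + h (x, y', z)) ->
  ambient_isotopic (in_S3 A) (in_S3 ((fun p => (p.1.1, p.1.2 + h p, p.2)) @` A)).
Proof.
move=> hc hC hm; rewrite (_ : (fun p => _) = (fun p => p + h p *: (0, 1, 0))).
  apply: (shift_isotopic A hc hC) => -[[x y] z] s s0; rewrite add_scale_y.
  by have := hm x y (y + s) z; rewrite ltrDl -addrA ltrD2l; exact.
by apply/funext => -[[x y] z]; rewrite add_scale_y.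
Qed.

Lemma shift_z_isotopic h C A : continuous h -> (forall p, `|h p| <= C) ->
  (forall x y z z', z < z' -> z + h (x, y, z) < z' + h (x, y, z')) ->
  ambient_isotopic (in_S3 A) (in_S3 ((fun p => (p.1, p.2 + h p)) @` A)).
Proof.
move=> hc hC hm; rewrite (_ : (fun p => _) = (fun p => p + h p *: (0, 0, 1))).
  apply: (shift_isotopic A hc hC) => -[[x y] z] s s0; rewrite add_scale_z.
  by have := hm x y z (z + s); rewrite ltrDl -addrA ltrD2l; exact.
by apply/funext => -[[x y] z]; rewrite add_scale_z.
Qed.

Lemma translate_isotopic v A :
  ambient_isotopic (in_S3 A) (in_S3 ((fun p => p + v) @` A)).
Proof.
rewrite (_ : (fun p => _) = (fun p => p + (fun=> 1 : R) p *: v)).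
  apply: (@shift_isotopic _ (fun=> 1) v 1); first exact: cont_cst.
    by move=> p; rewrite normr1.
  by move=> p s s0; rewrite ltrDr.
by apply/funext => p; rewrite scale1r.
Qed.

End Shift.

(** * The wrapping map *)

Section Wrap.
Variables (R : realType) (N : R) (cond : bool -> bool -> bool).
Hypothesis N1 : 1 <= N.

(** Distance from x to [0, N]. *)
Definition overshoot (x : R) := Num.max 0 (Num.max (x - N) (- x)).
Definition clamp_half (d : R) := Num.max 0 (Num.min (1/2) d).
Definition half_excess (d x : R) := Num.min d (Num.max 0 (x / 2)).

(** At depth d in [0, 1/2], x |-> x - squeeze d x carries [-d, N + d] onto [0, N] and
    fixes [1/2, N - 1/2]. *)
Definition squeeze (d x : R) :=
  half_excess d (x - N + 1/2) - half_excess d (1/2 - x).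

(** The truncation at 1 only serves to bound the displacement: the mosaic stays at
    distance at most 1/2 from the square. *)
Definition tilt (p : R3 R) : R3 R :=
  (p.1, p.2 - Num.min 1 (overshoot p.1.1 + overshoot p.1.2)).

(** Subtracting the overshoot of y from the depth gives the overshoot of x on the tilted
    plane. Thus the sides y = 0 and y = N are left alone, and a corner arc is carried
    into the plane of a wall. *)
Definition push_x (p : R3 R) : R3 R :=
  (p.1.1 - squeeze (clamp_half (N - p.2 - overshoot p.1.2)) p.1.1, p.1.2, p.2).

(** Here the full depth is used, as every point of the mosaic below height N has x in
    [0, N] by now. *)
Definition push_y (p : R3 R) : R3 R :=
  (p.1.1, p.1.2 - squeeze (clamp_half (N - p.2)) p.1.2, p.2).
Definition mirror (a : bool) (x : R) := if a then x else N - x.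

(** Here w measures the distance along the wall a from the point 1/2 before its end b.
    Below height N, the path to be straightened is the graph of max (-2 w, -1/2) and the
    straight arc is the graph of - w; their difference is min (w, 1/2 - w).  The
    subtracted terms cut the support down to a small neighbourhood of the path below the
    top face, with slope 1/2 in the vertical direction, which keeps the shift
    increasing. *)
Definition bump (a b : bool) (p : R3 R) :=
  let w := mirror b p.1.2 - N + 1/2 in
  Num.min w (1/2 - w) - `|mirror a p.1.1 - N| - `|p.2 - N - Num.max (-2 * w) (-1/2)|/2.
Definition lift_height (p : R3 R) :=
  let h a b := if cond a b then Num.max 0 (bump a b p) else 0 in
  Num.max (Num.max (h true true) (h true false)) (Num.max (h false true) (h false false)).
Definition straighten (p : R3 R) : R3 R := (p.1, p.2 + lift_height p).
Definition wrap (p : R3 R) : R3 R := straighten (push_y (push_x (tilt p))).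

Lemma half_excess_slope (d x x' : R) : x <= x' ->
  half_excess d x' - half_excess d x <= (x' - x) / 2.
Proof. by rewrite /half_excess => xx'; minmax. Qed.

Lemma half_excess_neg (d x : R) : x <= 0 -> half_excess d x = half_excess d 0.
Proof. by rewrite /half_excess => x0; rewrite !max_l //; lra. Qed.

(** Each of the two terms of [squeeze] has slope at most 1/2, and they vary on opposite
    sides of 1/2. *)
Lemma squeeze_slope (d x x' : R) : x < x' -> x - squeeze d x < x' - squeeze d x'.
Proof.
move=> xx'; rewrite /squeeze; have N1' := N1.
have slope u u' : u <= u' -> half_excess d u' <= half_excess d u + (u' - u) / 2.
  by move/(half_excess_slope d); lra.
have [x1|x1] := le_or_lt (1/2) x.
  rewrite (half_excess_neg d (_ : 1/2 - x <= 0)); last lra.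
  rewrite (half_excess_neg d (_ : 1/2 - x' <= 0)); last lra.
  have /slope : x - N + 1/2 <= x' - N + 1/2 by lra.
  lra.
have [x'1|x'1] := le_or_lt x' (1/2).
  rewrite (half_excess_neg d (_ : x - N + 1/2 <= 0)); last lra.
  rewrite (half_excess_neg d (_ : x' - N + 1/2 <= 0)); last lra.
  have /slope : 1/2 - x' <= 1/2 - x by lra.
  lra.
rewrite [half_excess d (1/2 - x')]half_excess_neg; last lra.
rewrite [half_excess d (x - N + 1/2)]half_excess_neg; last lra.
have /slope : 0 <= x' - 1/2 by lra.
have /slope : 0 <= 1/2 - x by lra.
have : half_excess d (x' - N + 1/2) <= half_excess d (x' - 1/2).
  by rewrite /half_excess; minmax.
lra.
Qed.

Lemma squeeze_bound (d x : R) : 0 <= d <= 1/2 -> `|squeeze d x| <= 1.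
Proof.
move=> /andP[d0 d1]; have h y : 0 <= half_excess d y <= 1/2.
  by rewrite /half_excess; apply/andP; split; minmax.
have /andP[? ?] := h (x - N + 1/2); have /andP[? ?] := h (1/2 - x).
by rewrite ler_norml /squeeze; apply/andP; split; lra.
Qed.

Lemma clamp_half_itv (d : R) : 0 <= clamp_half d <= 1/2.
Proof. by rewrite /clamp_half; apply/andP; split; minmax. Qed.

Lemma bump_slope a b (x y z z' : R) : z < z' ->
  z + Num.max 0 (bump a b (x, y, z)) < z' + Num.max 0 (bump a b (x, y, z')).
Proof. by move=> zz'; rewrite /bump /=;
  move: (_ - `|mirror _ _ - _|) (Num.max _ (_ / _)) => u v; minmax. Qed.

Lemma max_slope (a b c d z z' : R) : z + a < z' + c -> z + b < z' + d ->
  z + Num.max a b < z' + Num.max c d.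
Proof. by move=> ? ?; minmax. Qed.

Lemma lift_slope (x y z z' : R) : z < z' ->
  z + lift_height (x, y, z) < z' + lift_height (x, y, z').
Proof.
move=> zz'; rewrite /lift_height.
by do !apply: max_slope; case: cond; rewrite ?addr0 //; exact: bump_slope.
Qed.

Lemma lift_bound p : `|lift_height p| <= 1.
Proof.
have bump1 a b : bump a b p <= 1.
  rewrite /bump; set w := _ - N + _.
  have := normr_ge0 (p.2 - N - Num.max (-2 * w) (-1/2)).
  have := normr_ge0 (mirror a p.1.1 - N).
  by move: `|_ - N| `|_ - _ - Num.max _ _| => u v u0 v0; minmax.
have h a b : 0 <= (if cond a b then Num.max 0 (bump a b p) else 0) <= 1.
  case: cond; last by rewrite lexx ler01.
  by rewrite le_max lexx ge_max ler01 bump1.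
rewrite /lift_height.
have /andP[? ?] := h true true; have /andP[? ?] := h true false.
have /andP[? ?] := h false true; have /andP[? ?] := h false false.
by rewrite ger0_norm; [rewrite !ge_max; do !(apply/andP; split)|rewrite !le_max; apply/orP;
  left; apply/orP; left].
Qed.

Lemma tilt_isotopic (A : set (R3 R)) : ambient_isotopic (in_S3 A) (in_S3 (tilt @` A)).
Proof.
apply: (@shift_z_isotopic _ (fun p => - Num.min 1 (overshoot p.1.1 + overshoot p.1.2)) 1).
- by rewrite /overshoot; continuity.
- move=> p; rewrite normrN ger0_norm; first by rewrite ge_min lexx.
  by rewrite le_min ler01 /= addr_ge0 // le_max lexx.
- by move=> x y z z' zz'; rewrite ltrD2r.
Qed.

Lemma push_x_isotopic (A : set (R3 R)) : ambient_isotopic (in_S3 A) (in_S3 (push_x @` A)).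
Proof.
apply: (@shift_x_isotopic _ (fun p => - squeeze (clamp_half (N - p.2 - overshoot p.1.2)) p.1.1)
  1).
- by rewrite /squeeze /half_excess /clamp_half /overshoot; continuity.
- by move=> p; rewrite normrN; apply/squeeze_bound/clamp_half_itv.
- by move=> x x' y z xx'; exact: squeeze_slope.
Qed.

Lemma push_y_isotopic (A : set (R3 R)) : ambient_isotopic (in_S3 A) (in_S3 (push_y @` A)).
Proof.
apply: (@shift_y_isotopic _ (fun p => - squeeze (clamp_half (N - p.2)) p.1.2) 1).
- by rewrite /squeeze /half_excess /clamp_half; continuity.
- by move=> p; rewrite normrN; apply/squeeze_bound/clamp_half_itv.
- by move=> x y y' z yy'; exact: squeeze_slope.
Qed.

Lemma straighten_isotopic (A : set (R3 R)) :
  ambient_isotopic (in_S3 A) (in_S3 (straighten @` A)).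
Proof.
apply: (@shift_z_isotopic _ lift_height 1); last exact: lift_slope.
- rewrite /lift_height /bump /mirror.
  by case: (cond true true); case: (cond true false); case: (cond false true);
    case: (cond false false); continuity.
- exact: lift_bound.
Qed.

Lemma wrap_isotopic (A : set (R3 R)) : ambient_isotopic (in_S3 A) (in_S3 (wrap @` A)).
Proof.
rewrite (_ : wrap @` A = straighten @` (push_y @` (push_x @` (tilt @` A))));
  last by rewrite !image_comp.
apply: ambient_isotopic_trans (straighten_isotopic _).
apply: ambient_isotopic_trans (push_y_isotopic _).
exact: ambient_isotopic_trans (tilt_isotopic _) (push_x_isotopic _).
Qed.

End Wrap.

(** * Values of the wrapping map on the boundary ring *)

Section WrapValues.
Variables (R : realType) (N : R) (cond : bool -> bool -> bool).
Hypothesis N1 : 1 <= N.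

Definition wall (a : bool) : R := if a then N else 0.
Definition outward (a : bool) : R := if a then 1 else -1.

Lemma overshoot_in (x : R) : 0 <= x <= N -> overshoot N x = 0.
Proof. by move=> /andP[x0 xN]; rewrite /overshoot; minmax. Qed.

Lemma overshoot_out a (d : R) : 0 <= d -> overshoot N (wall a + outward a * d) = d.
Proof. by have N1' := N1; move=> d0; rewrite /overshoot /wall /outward; case: a; minmax. Qed.

Lemma clamp_half_id (d : R) : 0 <= d <= 1/2 -> clamp_half d = d.
Proof. by move=> /andP[x0 xN]; rewrite /clamp_half; minmax. Qed.

Lemma squeeze0 (x : R) : squeeze N 0 x = 0.
Proof. by rewrite /squeeze /half_excess; minmax. Qed.

Lemma squeeze_mid (d x : R) : 0 <= d -> 1/2 <= x <= N - 1/2 -> squeeze N d x = 0.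
Proof.
move=> d0 /andP[x1 xN]; rewrite /squeeze /half_excess.
by rewrite !(max_l (_ : _ / 2 <= 0)); lra.
Qed.

(** The number u is the distance past the point 1/2 before the end b. *)
Lemma squeeze_end b (d u : R) : 0 <= d -> 0 <= u ->
  squeeze N d (wall b + outward b * (u - 1/2)) = outward b * Num.min d (u / 2).
Proof.
have N1' := N1; move=> d0 u0; rewrite /squeeze /half_excess /wall /outward.
have u2 : 0 <= u / 2 by lra.
case: b.
  have -> : N + 1 * (u - 1/2) - N + 1/2 = u by lra.
  have e2 : (1/2 - (N + 1 * (u - 1/2))) / 2 <= 0 by lra.
  by rewrite (max_r u2) (max_l e2) (min_r d0) subr0 mul1r.
have -> : 1/2 - (0 + -1 * (u - 1/2)) = u by lra.
have e2 : (0 + -1 * (u - 1/2) - N + 1/2) / 2 <= 0 by lra.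
by rewrite (max_r u2) (max_l e2) (min_r d0) sub0r mulN1r.
Qed.

Definition push (p : R3 R) : R3 R := push_y N (push_x N (tilt N p)).

Lemma push_top (x y z : R) : 0 <= x <= N -> 0 <= y <= N -> N <= z ->
  push (x, y, z) = (x, y, z).
Proof.
move=> hx hy hz; rewrite /push /tilt /= !overshoot_in // addr0 min_r ?ler01// subr0.
have c d : d <= 0 -> clamp_half d = 0 by move=> d0; rewrite /clamp_half; minmax.
rewrite /push_x /= overshoot_in // c; last lra.
by rewrite squeeze0 subr0 /push_y /= c ?squeeze0 ?subr0 //; lra.
Qed.

Lemma push_end b (x d : R) : 0 <= x <= N -> 0 <= d <= 1/2 ->
  push (x, wall b + outward b * d, N) = (x, wall b, N - d).
Proof.
move=> hx /andP[d0 d1]; rewrite /push /tilt /= (overshoot_in hx) overshoot_out // add0r min_r;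
  last lra.
rewrite /push_x /= overshoot_out // (_ : N - (N - d) = d) ?subrr; last lra.
rewrite clamp_half_id ?squeeze0 ?subr0; last by apply/andP; split; lra.
rewrite /push_y /= (_ : N - (N - d) = d); last lra.
rewrite clamp_half_id; last by rewrite d0.
rewrite (_ : wall b + _ = wall b + outward b * ((d + 1/2) - 1/2)); last by congr (_ + _ * _); lra.
rewrite squeeze_end ?min_l //; [|lra..].
by congr (_, _, _); ring.
Qed.

Lemma push_side a (y d : R) : 0 <= y <= N -> 0 <= d <= 1/2 ->
  push (wall a + outward a * d, y, N) = (wall a, y - squeeze N d y, N - d).
Proof.
move=> hy /andP[d0 d1]; rewrite /push /tilt /= (overshoot_in hy) overshoot_out // addr0 min_r;
  last lra.
rewrite /push_x /= (overshoot_in hy) (_ : N - (N - d) - 0 = d); last lra.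
rewrite clamp_half_id; last by rewrite d0.
rewrite (_ : wall a + _ = wall a + outward a * ((d + 1/2) - 1/2)); last by congr (_ + _ * _); lra.
rewrite squeeze_end ?min_l //; [|lra..].
rewrite /push_y /= (_ : N - (N - d) = d); last lra.
rewrite clamp_half_id; last by rewrite d0.
by congr (_, _, _); ring.
Qed.

Lemma push_corner a b (e : R) : 0 <= e <= 1/2 ->
  push (wall a + outward a * (1/2 - e), wall b + outward b * e, N) =
  (wall a, wall b + outward b * (e / 2 - 1/4), N - 1/2).
Proof.
move=> /andP[e0 e1]; rewrite /push /tilt /= !overshoot_out; [|lra..].
rewrite subrK min_r; last lra.
rewrite /push_x /= overshoot_out // (_ : N - (N - 1/2) - e = 1/2 - e); last lra.
rewrite clamp_half_id; last by apply/andP; split; lra.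
rewrite (_ : wall a + _ = wall a + outward a * ((1/2 - e + 1/2) - 1/2));
  last by congr (_ + _ * _); lra.
rewrite squeeze_end ?min_l; [|lra..].
rewrite /push_y /= (_ : N - (N - 1/2) = 1/2); last lra.
rewrite clamp_half_id; last by apply/andP; split; lra.
rewrite (_ : wall b + _ = wall b + outward b * ((e + 1/2) - 1/2)); last by congr (_ + _ * _); lra.
rewrite squeeze_end ?min_r; [|lra..].
by congr (_, _, _); lra.
Qed.

Lemma straighten_id (p : R3 R) : (forall a b, cond a b -> bump N a b p <= 0) ->
  straighten N cond p = p.
Proof.
move=> h; rewrite /straighten; case: p h => [xy z] h.
suff -> : lift_height N cond (xy, z) = 0 by rewrite addr0.
have c a b : (if cond a b then Num.max 0 (bump N a b (xy, z)) else 0) = 0.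
  by case E: (cond a b) => //; apply/max_l/h.
by rewrite /lift_height !c !maxxx.
Qed.

Lemma lift_height_eq a b (p : R3 R) : cond a b -> 0 <= bump N a b p ->
  (forall a' b', (a', b') != (a, b) -> bump N a' b' p <= 0) ->
  lift_height N cond p = bump N a b p.
Proof.
move=> cab b0 h.
have c a' b' : (a', b') != (a, b) ->
    (if cond a' b' then Num.max 0 (bump N a' b' p) else 0) = 0.
  by move=> /h ?; case: (cond a' b') => //; exact/max_l.
have ce : (if cond a b then Num.max 0 (bump N a b p) else 0) = bump N a b p.
  by rewrite cab; exact/max_r.
rewrite /lift_height; case: a b cab b0 h c ce => -[] cab b0 h c ce;
  rewrite ce ?(c true true) ?(c true false) ?(c false true) ?(c false false) //;
  rewrite ?maxxx ?(max_l b0) ?(max_r b0) ?maxxx ?(max_l b0) ?(max_r b0) //.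
Qed.

Lemma straighten_above (x y z : R) : 0 <= y <= N -> N <= z ->
  straighten N cond (x, y, z) = (x, y, z).
Proof.
move=> /andP[y0 yN] hz; apply: straighten_id => a b _; rewrite /bump /=.
have : 0 <= `|mirror N a x - N| by exact: normr_ge0.
move: `|mirror _ _ _ - _| => u u0.
by have N1' := N1; rewrite /mirror; case: b; minmax.
Qed.

Lemma straighten_end b (x z : R) :
  straighten N cond (x, wall b, z) = (x, wall b, z).
Proof.
apply: straighten_id => a b' _; rewrite /bump /=.
have := normr_ge0 (mirror N a x - N); move: `|mirror _ _ _ - _| => u u0.
set w := _ - N + _; have := normr_ge0 (z - N - Num.max (-2 * w) (-1/2)).
move: `|z - N - _| => v v0.
suff : w <= 0 \/ 1/2 <= w by case=> ?; minmax.
have N1' := N1.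
by rewrite /w; clear w v v0; rewrite /mirror /wall; case: b' b => -[]; [right|left|left|right];
  lra.
Qed.

(** Only the bumps at the two ends of the wall a reach it, each within distance 1/2 of
    its end. *)
Lemma straighten_side a (y z : R) :
  y <= N - 1/2 \/ ~~ cond a true -> 1/2 <= y \/ ~~ cond a false ->
  straighten N cond (wall a, y, z) = (wall a, y, z).
Proof.
move=> h1 h2; apply: straighten_id => a' b c; rewrite /bump /=.
have N1' := N1.
set w := _ - N + _; have := normr_ge0 (z - N - Num.max (-2 * w) (-1/2)).
move: `|z - N - _| => v v0.
have := normr_ge0 (mirror N a' (wall a) - N).
have [a'a|a'a] := eqVneq a' a; last first.
  move=> _; have -> : `|mirror N a' (wall a) - N| = N.
    by rewrite /mirror /wall; case: a' a a'a {h1 h2 c} => -[] // _; rewrite ler0_norm; lra.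
  minmax.
subst a'; move: `|mirror _ _ _ - _| => u u0.
suff : w <= 0 by move=> ?; minmax.
rewrite /w; clear w v v0; rewrite /mirror; case: b c => c.
  by case: h1 => [|/negP//]; lra.
by case: h2 => [|/negP//]; lra.
Qed.

(** On the bent path the bump equals min (w, 1/2 - w), while the three other bumps are
    nonpositive: they sit at distance N >= 1 from the wall, or on its other half. *)
Lemma straighten_corner a b (w : R) : cond a b -> 0 <= w <= 1/2 ->
  straighten N cond (wall a, wall b + outward b * (w - 1/2), N + Num.max (-2 * w) (-1/2)) =
  (wall a, wall b + outward b * (w - 1/2), N - w).
Proof.
have N1' := N1; move=> cab /andP[w0 w1]; rewrite /straighten /=; congr (_, _).
have bE : bump N a b (wall a, wall b + outward b * (w - 1/2), N + Num.max (-2 * w) (-1/2)) =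
    Num.min w (1/2 - w).
  rewrite /bump /=.
  have -> : mirror N a (wall a) - N = 0 by rewrite /mirror /wall; case: (a); lra.
  have -> : mirror N b (wall b + outward b * (w - 1/2)) - N + 1/2 = w.
    by rewrite /mirror /wall /outward; case: (b); lra.
  move: (Num.max (-2 * w) _) => M; have -> : N + M - N - M = 0 by ring.
  by rewrite normr0 mul0r !subr0.
rewrite (lift_height_eq cab) ?bE; first by minmax.
  by minmax.
move=> a' b' ab; rewrite /bump /=.
set w' := _ - N + _; have := normr_ge0 (N + Num.max (-2 * w) (-1 / 2) - N - Num.max (-2 * w')
  (-1/2)).
move: `|_ - _ - Num.max _ _| => v v0.
have [a'a|a'a] := eqVneq a' a; last first.
  have -> : `|mirror N a' (wall a) - N| = N.
    by rewrite /mirror /wall; case: a' a a'a {ab cab bE} => -[] // _; rewrite ler0_norm; lra.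
  minmax.
have := normr_ge0 (mirror N a' (wall a) - N).
move: `|mirror _ _ _ - _| => u u0.
suff : w' <= 0 by move=> ?; minmax.
by rewrite /w'; clear w' v v0 u u0; rewrite /mirror /wall /outward;
  case: b' b ab {cab bE} => -[]; rewrite a'a ?eqxx //; lra.
Qed.

End WrapValues.
Arguments outward {R} a.

Lemma itv01P (R : realType) (a b x : R) : (`[a, b]%classic x) <-> a <= x <= b.
Proof. by rewrite /= in_itv. Qed.

(** * Images of the arcs of the boundary ring *)

Section WrapImages.
Variables (R : realType) (N : R) (cond : bool -> bool -> bool).
Hypothesis N1 : 1 <= N.
Local Notation wrap := (wrap N cond).
Local Notation I := (`[0, 1/2]%classic : set R).

(** Arcs of the ring next to the wall a, and their intended positions on that wall: a
    quarter turn towards the end b, starting at the point of ordinate y of the top of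
    the wall; a line along the wall; and the arc of the corner tile at the end b. *)
Definition flat_arc a b (y : R) : set (R3 R) :=
  [set (wall N a + outward a * d, y + outward b * d, N) | d in I].
Definition steep_arc a b (y : R) : set (R3 R) :=
  [set (wall N a, y + outward b * d, N - d) | d in I].
Definition flat_line a (y : R) : set (R3 R) :=
  [set (wall N a + outward a * (1/2), t, N) | t in `[y, y + 1]%classic].
Definition steep_line a (y : R) : set (R3 R) :=
  [set (wall N a, t, N - 1/2) | t in `[y, y + 1]%classic].
Definition corner_arc a b : set (R3 R) :=
  [set (wall N a + outward a * (1/2 - e), wall N b + outward b * e, N) | e in I].

Lemma wrapE p : wrap p = straighten N cond (push N p).
Proof. by []. Qed.

Lemma wrap_top (x y z : R) : 0 <= x <= N -> 0 <= y <= N -> N <= z ->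
  wrap (x, y, z) = (x, y, z).
Proof. by move=> hx hy hz; rewrite wrapE push_top // straighten_above. Qed.

Lemma wrap_end b (x d : R) : 0 <= x <= N -> 0 <= d <= 1/2 ->
  wrap (x, wall N b + outward b * d, N) = (x, wall N b, N - d).
Proof. by move=> hx hd; rewrite wrapE push_end // straighten_end. Qed.

Lemma wrap_line a (y : R) : 0 <= y <= N ->
  y <= N - 1/2 \/ ~~ cond a true -> 1/2 <= y \/ ~~ cond a false ->
  wrap (wall N a + outward a * (1/2), y, N) = (wall N a, y - squeeze N (1/2) y, N - 1/2).
Proof.
have N1' := N1; move=> hy h1 h2; rewrite wrapE push_side //; last by apply/andP; split; lra.
have sq : (y <= N - 1/2 -> y - squeeze N (1/2) y <= N - 1/2) /\
          (1/2 <= y -> 1/2 <= y - squeeze N (1/2) y).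
  split=> yN.
    have [y1|y1] := le_or_lt (1/2) y.
      by rewrite squeeze_mid; [lra|lra|apply/andP; split; lra].
    have -> : y = wall N false + outward false * ((1/2 - y) - 1/2) by rewrite /wall /outward; lra.
    rewrite squeeze_end; [|lra..].
    by rewrite /wall /outward; minmax.
  have [y1|y1] := le_or_lt y (N - 1/2).
    by rewrite squeeze_mid; [lra|lra|apply/andP; split; lra].
  have -> : y = wall N true + outward true * ((y - N + 1/2) - 1/2) by rewrite /wall /outward; lra.
  rewrite squeeze_end; [|lra..].
  by rewrite /wall /outward; minmax.
by case: sq => s1 s2; apply: (straighten_side N1); [case: h1; [left; auto|right]|case: h2;
  [left; auto|right]].
Qed.

Lemma wrap_mid a (y d : R) : 1/2 <= y <= N - 1/2 -> 0 <= d <= 1/2 ->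
  wrap (wall N a + outward a * d, y, N) = (wall N a, y, N - d).
Proof.
move=> /andP[y1 y2] /andP[d0 d1]; rewrite wrapE push_side ?d0 //; last by apply/andP; split; lra.
by rewrite squeeze_mid ?y1 // subr0 straighten_side //; left.
Qed.

Lemma wrap_arc_end a b (d : R) : cond a b -> 0 <= d <= 1/2 ->
  wrap (wall N a + outward a * d, wall N b + outward b * (d - 1/2), N) =
  (wall N a, wall N b + outward b * (d / 2 - 1/2), N - d / 2).
Proof.
have N1' := N1; move=> cab /andP[d0 d1]; rewrite wrapE push_side ?d0 //;
  last by rewrite /wall /outward; case: (b); apply/andP; split; lra.
rewrite squeeze_end // min_r; last lra.
have := @straighten_corner _ _ _ N1 _ _ (d / 2) cab.
rewrite max_l; last lra.
have -> : N + -2 * (d / 2) = N - d by lra.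
have -> : wall N b + outward b * (d - 1/2) - outward b * (d / 2) = wall N b + outward b * (d /
  2 - 1/2) by rewrite /outward; case: (b); lra.
by apply; apply/andP; split; lra.
Qed.

Lemma wrap_corner_arc a b (e : R) : cond a b -> 0 <= e <= 1/2 ->
  wrap (wall N a + outward a * (1/2 - e), wall N b + outward b * e, N) =
  (wall N a, wall N b + outward b * (e / 2 - 1/4), N - (e / 2 + 1/4)).
Proof.
have N1' := N1; move=> cab /andP[d0 d1]; rewrite wrapE push_corner //; last by rewrite d0.
have := @straighten_corner _ _ _ N1 _ _ (e / 2 + 1/4) cab.
rewrite max_r; last lra.
have -> : N + -1/2 = N - 1/2 by lra.
have -> : e / 2 + 1/4 - 1/2 = e / 2 - 1/4 by lra.
by apply; apply/andP; split; lra.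
Qed.

Lemma wrap_corner_line a b (e : R) : ~~ cond a b -> 0 <= e <= 1/2 ->
  wrap (wall N a + outward a * (1/2 - e), wall N b + outward b * e, N) =
  (wall N a, wall N b + outward b * (e / 2 - 1/4), N - 1/2).
Proof.
have N1' := N1; move=> cab /andP[d0 d1]; rewrite wrapE push_corner //; last by rewrite d0.
by rewrite straighten_side //; rewrite /wall /outward; case: (b) cab => c; auto; left; lra.
Qed.

Lemma wrap_flat_arc_mid a b (y : R) : 1/2 <= y <= N - 1/2 ->
  1/2 <= y + outward b * (1/2) <= N - 1/2 -> wrap @` flat_arc a b y = steep_arc a b y.
Proof.
move=> /andP[y1 y2] h; rewrite /flat_arc image_comp; apply: eq_imagel => d /itv01P/andP[d0 d1] /=.
apply: wrap_mid; last by rewrite d0.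
by move: h; rewrite /outward; case: b => /andP[? ?]; apply/andP; split; lra.
Qed.

(** The quarter turn is carried to the upper half of the straight arc and the corner arc
    to its lower half, in both cases at half speed. *)
Lemma wrap_flat_arc_end a b : cond a b ->
  wrap @` (flat_arc a b (wall N b - outward b * (1/2)) `|` corner_arc a b) =
  steep_arc a b (wall N b - outward b * (1/2)).
Proof.
move=> cab; rewrite image_setU; apply/seteqP; split=> p.
  case=> -[_ [d /itv01P/andP[d0 d1] <-] <-].
    have -> : wall N b - outward b * (1/2) + outward b * d = wall N b + outward b * (d - 1/2)
      by ring.
    rewrite wrap_arc_end // ?d0 //; exists (d / 2); first by apply/itv01P/andP; split; lra.
    by congr (_, _, _); ring.
  rewrite wrap_corner_arc // ?d0 //; exists (d / 2 + 1/4); first by apply/itv01P/andP; split; lra.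
  by congr (_, _, _); lra.
move=> [w /itv01P/andP[w0 w1] <-]; have [w4|w4] := le_or_lt w (1/4); [left|right].
  exists (wall N a + outward a * (2 * w), wall N b - outward b * (1/2) + outward b * (2 * w), N).
    by exists (2 * w) => //; apply/itv01P/andP; split; lra.
  have -> : wall N b - outward b * (1/2) + outward b * (2 * w) = wall N b + outward b * (2 * w
    - 1/2) by ring.
  rewrite wrap_arc_end //; last by apply/andP; split; lra.
  by congr (_, _, _); lra.
exists (wall N a + outward a * (1/2 - (2 * w - 1/2)), wall N b + outward b * (2 * w - 1/2), N).
  by exists (2 * w - 1/2) => //; apply/itv01P/andP; split; lra.
rewrite wrap_corner_arc //; last by apply/andP; split; lra.
by congr (_, _, _); lra.
Qed.

(** The line is squeezed by 1/4 near each end of the wall that it reaches, and the image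
    of the corner arc fills exactly the gap.  At such an end nothing may be
    straightened, whence the hypotheses on cond. *)
Lemma wrap_flat_line a (y : R) (top bot : bool) :
  (if top then y + 1 = N else y + 1 <= N - 1/2) ->
  (if bot then y = 0 else 1/2 <= y) ->
  (top -> ~~ cond a true) -> (bot -> ~~ cond a false) ->
  wrap @` (flat_line a y `|` (if top then corner_arc a true else set0)
             `|` (if bot then corner_arc a false else set0)) = steep_line a y.
Proof.
move=> htop hbot ctop cbot.
have N1' := N1.
have y0 : 0 <= y by case: (bot) hbot; lra.
have yN : y + 1 <= N by case: (top) htop; lra.
have line t : y <= t <= y + 1 ->
    wrap (wall N a + outward a * (1/2), t, N) = (wall N a, t - squeeze N (1/2) t, N - 1/2).
  move=> /andP[t0 t1]; apply: wrap_line; first by apply/andP; split; lra.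
    by case: (top) htop ctop => [_ /(_ isT)|? _]; [right|left; lra].
  by case: (bot) hbot cbot => [_ /(_ isT)|? _]; [right|left; lra].
have sq_hi (t : R) : N - 1/2 <= t <= N -> t - squeeze N (1/2) t = N - 1/2 + (t - N + 1/2) / 2.
  move=> /andP[t0 t1]; have {1 2}-> : t = wall N true + outward true * ((t - N + 1/2) - 1/2) by
    rewrite /wall /outward; lra.
  by rewrite squeeze_end ?min_r; [rewrite /wall /outward|..]; lra.
have sq_lo (t : R) : 0 <= t <= 1/2 -> t - squeeze N (1/2) t = 1/2 - (1/2 - t) / 2.
  move=> /andP[t0 t1]; have {1 2}-> : t = wall N false + outward false * ((1/2 - t) - 1/2) by
    rewrite /wall /outward; lra.
  by rewrite squeeze_end ?min_r; [rewrite /wall /outward|..]; lra.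
have sq_mid (t : R) : 1/2 <= t <= N - 1/2 -> t - squeeze N (1/2) t = t.
  by move=> ht; rewrite squeeze_mid ?subr0 //; lra.
rewrite !image_setU; apply/seteqP; split=> p.
  case=> [[]|].
  - move=> [_ [t /itv01P/andP[t0 t1] <-] <-]; rewrite line ?t0 //.
    exists (t - squeeze N (1/2) t) => //; apply/itv01P.
    have [h1|h1] := le_or_lt t (1/2).
      rewrite sq_lo; last by apply/andP; split; lra.
      by case: (bot) hbot => h; apply/andP; split; lra.
    have [h2|h2] := le_or_lt t (N - 1/2).
      by rewrite sq_mid ?t0 //; apply/andP; split; lra.
    rewrite sq_hi; last by apply/andP; split; lra.
    by case: (top) htop => h; apply/andP; split; lra.
  - case: (top) htop ctop => [htop /(_ isT) c|_ _]; last by rewrite image_set0.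
    move=> [_ [e /itv01P/andP[e0 e1] <-] <-]; rewrite wrap_corner_line // ?e0 //.
    by exists (wall N true + outward true * (e / 2 - 1/4)) => //; apply/itv01P;
      rewrite /wall /outward; apply/andP; split; lra.
  - case: (bot) hbot cbot => [hbot /(_ isT) c|_ _]; last by rewrite image_set0.
    move=> [_ [e /itv01P/andP[e0 e1] <-] <-]; rewrite wrap_corner_line // ?e0 //.
    by exists (wall N false + outward false * (e / 2 - 1/4)) => //; apply/itv01P;
      rewrite /wall /outward; apply/andP; split; lra.
have lineI t u : y <= t <= y + 1 -> t - squeeze N (1/2) t = u ->
    (wrap @` flat_line a y) (wall N a, u, N - 1/2).
  by move=> ht <-; rewrite -line //; apply: imageP; exists t => //; apply/itv01P.
move=> [t /itv01P/andP[t0 t1] <-].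
have [h1|h1] := le_or_lt t (1/2).
  case: (bot) hbot cbot => [hbot /(_ isT) c|h _]; last first.
    by left; left; apply: (lineI t); [rewrite t0|apply: sq_mid; apply/andP; split; lra].
  have [h4|h4] := le_or_lt (1/4) t.
    left; left; apply: (lineI (2 * t - 1/2)); first by apply/andP; split; lra.
    by rewrite sq_lo; [lra|apply/andP; split; lra].
  right; exists (wall N a + outward a * (1/2 - (1/2 - 2 * t)), wall N false + outward false *
    (1/2 - 2 * t), N).
    by exists (1/2 - 2 * t) => //; apply/itv01P/andP; split; lra.
  rewrite wrap_corner_line //; last by apply/andP; split; lra.
  by congr (_, _, _); rewrite /wall /outward; lra.
have [h2|h2] := le_or_lt t (N - 1/2).
  by left; left; apply: (lineI t); [rewrite t0|apply: sq_mid; apply/andP; split; lra].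
left; case: (top) htop ctop => [htop /(_ isT) c|h _]; last by exfalso; lra.
have [h4|h4] := le_or_lt t (N - 1/4).
  left; apply: (lineI (2 * t - N + 1/2)); first by apply/andP; split; lra.
  by rewrite sq_hi; [lra|apply/andP; split; lra].
right; exists (wall N a + outward a * (1/2 - (2 * (t - N) + 1/2)), wall N true + outward true *
  (2 * (t - N) + 1/2), N).
  by exists (2 * (t - N) + 1/2) => //; apply/itv01P/andP; split; lra.
rewrite wrap_corner_line //; last by apply/andP; split; lra.
by congr (_, _, _); rewrite /wall /outward; lra.
Qed.

(** The sides of the ring along y = 0 and y = N are obtained from those along x = 0 and
    x = N. *)
Definition swap_xy (p : R3 R) : R3 R := (p.1.2, p.1.1, p.2).

Lemma wrap_flat_arc_end_y a b (x : R) : 1/2 <= x <= N - 1/2 ->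
  wrap @` (swap_xy @` flat_arc a b x) = swap_xy @` steep_arc a b x.
Proof.
move=> /andP[x1 x2]; rewrite !image_comp; apply: eq_imagel => d /itv01P/andP[d0 d1].
rewrite /comp /swap_xy [LHS]wrap_end // ?d0 //.
by rewrite /outward /=; case: (b); apply/andP; split; lra.
Qed.

Lemma wrap_flat_line_y a (x : R) : 0 <= x <= N - 1 ->
  wrap @` (swap_xy @` flat_line a x) = swap_xy @` steep_line a x.
Proof.
move=> /andP[x1 x2]; rewrite !image_comp; apply: eq_imagel => d /itv01P/andP[d0 d1].
rewrite /comp /swap_xy [LHS]wrap_end //=; apply/andP; split; lra.
Qed.

End WrapImages.

(** * Tiles as unions of arcs *)

Section Cells.
Variables (R : realType) (N : R).

Definition cell (Q : square R) (T : tile) : set (R3 R) :=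
  [set p | exists2 a, a \in tile_arcs T & arc_set Q T a p].

Lemma mosaic_setE (J : finType) (sq : J -> square R) (M : J -> tile) :
  mosaic_set sq M = \bigcup_q cell (sq q) (M q).
Proof.
apply/seteqP; split=> p.
  by move=> [[q a] /= Ma pa]; exists q => //; exists a.
by move=> [q _ [a Ma pa]]; exists (q, a).
Qed.

Lemma cell_T0 Q : cell Q T0 = set0.
Proof. by apply/seteqP; split=> p // [a]. Qed.

Lemma cell_one Q T a : tile_arcs T = [:: a] ->
  cell Q T = segment (midpoint Q a.1) (midpoint Q a.2).
Proof.
move=> Ta; have oT : over_arc T a = false by case: T Ta.
apply/seteqP; split=> p.
  by move=> [c]; rewrite Ta inE => /eqP ->; rewrite /arc_set oT.
by move=> pa; exists a; rewrite ?Ta ?inE // /arc_set oT.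
Qed.

Definition shift_square (v : R3 R) (Q : square R) : square R :=
  Square (sq_corner Q + v) (sq_right Q) (sq_up Q) (sq_normal Q).

Lemma sq_point_shift v Q a b h : sq_point (shift_square v Q) a b h = sq_point Q a b h + v.
Proof. by rewrite /sq_point /= -!addrA; congr (_ + _); rewrite addrC -!addrA. Qed.

Lemma segment_shift (v a b : R3 R) : (fun p => p + v) @` segment a b = segment (a + v) (b + v).
Proof.
rewrite /segment image_comp; apply: eq_imagel => t _ /=.
by rewrite !scalerDr addrACA -scalerDl subrK scale1r.
Qed.

Lemma midpoint_shift v Q s : midpoint (shift_square v Q) s = midpoint Q s + v.
Proof. by case: s; rewrite /midpoint sq_point_shift. Qed.

Lemma arc_set_shift v Q T a :
  (fun p => p + v) @` arc_set Q T a = arc_set (shift_square v Q) T a.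
Proof.
rewrite /arc_set !midpoint_shift /apex sq_point_shift.
by case: over_arc; rewrite ?image_setU !segment_shift.
Qed.

Lemma cell_shift v Q T : (fun p => p + v) @` cell Q T = cell (shift_square v Q) T.
Proof.
apply/seteqP; split=> p.
  move=> [q [a Ta qa] <-]; exists a => //; rewrite -arc_set_shift; exact: imageP.
by move=> [a Ta]; rewrite -arc_set_shift => -[q qa <-]; exists q => //; exists a.
Qed.

(** Squares of the planar grid at height N, and squares of the top rows of the walls x =
    0, x = N and y = 0, y = N, with the frames of the spherical grid. *)
Definition flat_square (x y : R) : square R := Square (x, y, N) (1, 0, 0) (0, 1, 0) (0, 0, 1).
Definition steep_square a (y : R) : square R :=
  if a then Square (N, y, N - 1) (0, 1, 0) (0, 0, 1) (1, 0, 0)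
  else Square (0, y, N - 1) (0, 0, 1) (0, 1, 0) (-1, 0, 0).
Definition steep_square_y a (x : R) : square R :=
  if a then Square (x, N, N - 1) (0, 0, 1) (1, 0, 0) (0, 1, 0)
  else Square (x, 0, N - 1) (1, 0, 0) (0, 0, 1) (0, -1, 0).

(** Lower corner coordinate of the ring squares outside the end a. *)
Definition beyond (a : bool) : R := if a then N else -1.

(** On the faces x = N and y = N the frame of a folded ring square is rotated by a
    quarter turn; on the faces x = 0 and y = 0 it agrees with the planar frame.  Only
    the tiles that occur in the corresponding side of the ring are turned. *)
Definition turnX1 (T : tile) := match T with T1 => T4 | T4 => T3 | T6 => T5 | _ => T0 end.
Definition turnY1 (T : tile) := match T with T1 => T2 | T2 => T3 | T5 => T6 | _ => T0 end.
Definition turnX a T := if a then turnX1 T else T.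
Definition turnY a T := if a then turnY1 T else T.

(** The tile of a ring square outside the wall x = 0 or x = N whose arc joins the inner
    side to the side facing the end b; similarly for y, and for corner squares. *)
Definition tileX (a b : bool) : tile :=
  if a then (if b then T4 else T1) else (if b then T3 else T2).
Definition tileY (a b : bool) : tile :=
  if a then (if b then T2 else T1) else (if b then T3 else T4).
Definition tile_corner (a b : bool) : tile :=
  if a then (if b then T1 else T4) else (if b then T2 else T3).

Lemma segment_image (u u' : R) (f : R -> R3 R) (a b : R3 R) : u < u' ->
  (forall t : R, (1 - t) *: a + t *: b = f (u + t * (u' - u))) \/
  (forall t : R, (1 - t) *: a + t *: b = f (u' - t * (u' - u))) ->
  segment a b = f @` `[u, u']%classic.
Proof.
move=> uu' h; have du : 0 < u' - u by rewrite subr_gt0.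
have tK (t : R) : t / (u' - u) * (u' - u) = t by rewrite divfK // gt_eqF.
have t01 (t : R) : 0 <= t <= u' - u -> 0 <= t / (u' - u) <= 1.
  by move=> /andP[t0 t1]; rewrite ler_pdivlMr // ler_pdivrMr // mul0r mul1r t0.
have mt (t : R) : 0 <= t <= 1 -> 0 <= t * (u' - u) <= u' - u.
  by move=> /andP[t0 t1]; apply/andP; split; [apply: mulr_ge0 => //;
    exact: ltW|apply: ler_piMl => //; exact: ltW].
case: h => h; apply/seteqP; split=> p [t /itv01P ht <-].
- rewrite h; exists (u + t * (u' - u)) => //; apply/itv01P.
  by have /andP[? ?] := mt _ ht; apply/andP; split; lra.
- exists ((t - u) / (u' - u)); last by rewrite h tK; congr f; ring.
  by apply/itv01P/t01; move: ht => /andP[? ?]; apply/andP; split; lra.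
- rewrite h; exists (u' - t * (u' - u)) => //; apply/itv01P.
  by have /andP[? ?] := mt _ ht; apply/andP; split; lra.
- exists ((u' - t) / (u' - u)); last by rewrite h tK; congr f; ring.
  by apply/itv01P/t01; move: ht => /andP[? ?]; apply/andP; split; lra.
Qed.

Lemma comb3 (t a1 a2 a3 b1 b2 b3 : R) :
  (1 - t) *: ((a1, a2, a3) : R3 R) + t *: ((b1, b2, b3) : R3 R) =
  ((1 - t) * a1 + t * b1, (1 - t) * a2 + t * b2, (1 - t) * a3 + t * b3).
Proof. by []. Qed.

Lemma sq_point3 (c1 c2 c3 r1 r2 r3 u1 u2 u3 n1 n2 n3 a b h : R) :
  sq_point (Square (c1, c2, c3) (r1, r2, r3) (u1, u2, u3) (n1, n2, n3)) a b h =
  (c1 + a * r1 + b * u1 + h * n1, c2 + a * r2 + b * u2 + h * n2, c3 + a * r3 + b * u3 + h * n3).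
Proof. by []. Qed.

Ltac cell_tac := erewrite cell_one; [|reflexivity]; cbn [fst snd midpoint]; rewrite ?sq_point3;
  apply: segment_image; [lra|];
  first [by left=> t; rewrite comb3 /swap_xy /=; congr (_, _, _); field
        |by right=> t; rewrite comb3 /swap_xy /=; congr (_, _, _); field].

Lemma cell_flat_arc a b (y : R) :
  cell (flat_square (beyond a) y) (tileX a b) = flat_arc N a b (y + 1/2).
Proof. by rewrite /flat_square /beyond /flat_arc /wall /outward; case: a b => -[]; cell_tac. Qed.

Lemma cell_flat_line a (y : R) : cell (flat_square (beyond a) y) T6 = flat_line N a y.
Proof. by rewrite /flat_square /beyond /flat_line /wall /outward; case: a; cell_tac. Qed.

Lemma cell_corner_arc a b :
  cell (flat_square (beyond a) (beyond b)) (tile_corner a b) = corner_arc N a b.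
Proof. by rewrite /flat_square /beyond /corner_arc /wall /outward; case: a b => -[];
  cell_tac. Qed.

Lemma cell_steep_arc a b (y : R) :
  cell (steep_square a y) (turnX a (tileX a b)) = steep_arc N a b (y + 1/2).
Proof. by rewrite /steep_square /steep_arc /wall /outward; case: a b => -[]; cell_tac. Qed.

Lemma cell_steep_line a (y : R) : cell (steep_square a y) (turnX a T6) = steep_line N a y.
Proof. by rewrite /steep_square /steep_line /wall /outward; case: a; cell_tac. Qed.

Lemma cell_flat_arc_y a b (x : R) :
  cell (flat_square x (beyond a)) (tileY a b) = @swap_xy R @` flat_arc N a b (x + 1/2).
Proof. by rewrite image_comp /flat_square /beyond /wall /outward; case: a b => -[]; cell_tac. Qed.

Lemma cell_flat_line_y a (x : R) :
  cell (flat_square x (beyond a)) T5 = @swap_xy R @` flat_line N a x.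
Proof. by rewrite image_comp /flat_square /beyond /wall /outward; case: a; cell_tac. Qed.

Lemma cell_steep_arc_y a b (x : R) :
  cell (steep_square_y a x) (turnY a (tileY a b)) = @swap_xy R @` steep_arc N a b (x + 1/2).
Proof. by rewrite image_comp /steep_square_y /wall /outward; case: a b => -[]; cell_tac. Qed.

Lemma cell_steep_line_y a (x : R) :
  cell (steep_square_y a x) (turnY a T5) = @swap_xy R @` steep_line N a x.
Proof. by rewrite image_comp /steep_square_y /wall /outward; case: a; cell_tac. Qed.

End Cells.

(** * Wrapping a planar mosaic around the cube *)

Section CubeMosaic.
Variables (n : nat) (Mn : nat -> nat -> tile).

Definition rim (a : bool) : nat := if a then n.+1 else 0.

(** The last index of a side of the ring before the corner at its end b. *)
Definition last_row (b : bool) : nat := if b then n else 1.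
Definition sideX (a : bool) : side := if a then sideR else sideL.
Definition sideY (a : bool) : side := if a then sideU else sideD.

Record planar_connected : Prop := PlanarConnected {
  connected_R : forall i j, (i <= n)%N -> (j <= n.+1)%N ->
    is_connection (Mn i j) sideR = is_connection (Mn i.+1 j) sideL;
  connected_U : forall i j, (i <= n.+1)%N -> (j <= n)%N ->
    is_connection (Mn i j) sideU = is_connection (Mn i j.+1) sideD;
  boundaryX : forall a j, (j <= n.+1)%N -> ~~ is_connection (Mn (rim a) j) (sideX a);
  boundaryY : forall a i, (i <= n.+1)%N -> ~~ is_connection (Mn i (rim a)) (sideY a)
}.

Definition cube_tile (q : face * (nat * nat)) : tile :=
  let: (f, (a, b)) := q in
  match f with
  | faceX0 => if a.+1 == n then Mn 0 b.+1 else T0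
  | faceX1 => if b.+1 == n then turnX1 (Mn n.+1 a.+1) else T0
  | faceY0 => if b.+1 == n then Mn a.+1 0 else T0
  | faceY1 => if a.+1 == n then turnY1 (Mn b.+1 n.+1) else T0
  | faceZ0 => T0
  | faceZ1 => Mn a.+1 b.+1
  end.

Definition is_line (T : tile) : bool := match T with T6 => true | _ => false end.

(** Straightening must be avoided at the ends of a side whose last tile is a line: there
    the image of the corner arc is already in place. *)
Definition slanted (a b : bool) : bool := ~~ is_line (Mn (rim a) (last_row b)).

End CubeMosaic.

(** A tile with no connection point on one side has at most one arc. *)
Lemma ring_tileX (T : tile) a : ~~ is_connection T (sideX a) ->
  [\/ T = T0, exists b, T = tileX a b | T = T6].
Proof.
by case: T a => -[] // _; try (by constructor 1); try (by constructor 3);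
  constructor 2; first [by exists true|by exists false].
Qed.

Lemma ring_tileY (T : tile) a : ~~ is_connection T (sideY a) ->
  [\/ T = T0, exists b, T = tileY a b | T = T5].
Proof.
by case: T a => -[] // _; try (by constructor 1); try (by constructor 3);
  constructor 2; first [by exists true|by exists false].
Qed.

Lemma ring_tile_corner (T : tile) a b :
  ~~ is_connection T (sideX a) -> ~~ is_connection T (sideY b) ->
  T = if is_connection T (sideY (~~ b)) then tile_corner a b else T0.
Proof. by case: T a b => -[] []. Qed.

(** A corner tile has two sides left, and an arc uses both of them. *)
Lemma corner_tile_sym (T : tile) a b :
  ~~ is_connection T (sideX a) -> ~~ is_connection T (sideY b) ->
  is_connection T (sideY (~~ b)) = is_connection T (sideX (~~ a)).
Proof. by case: T a b => -[] []. Qed.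

Lemma segment_box (R : realType) (a b p : R3 R) (x x' y y' z : R) :
  segment a b p ->
  [/\ x <= a.1.1 <= x', y <= a.1.2 <= y' & z <= a.2] ->
  [/\ x <= b.1.1 <= x', y <= b.1.2 <= y' & z <= b.2] ->
  [/\ x <= p.1.1 <= x', y <= p.1.2 <= y' & z <= p.2].
Proof.
case: a b p => [[a1 a2] a3] [[b1 b2] b3] [[p1 p2] p3] [t /itv01P/andP[t0 t1]].
rewrite comb3 => -[<- <- <-] /= [/andP[? ?] /andP[? ?] ?] [/andP[? ?] /andP[? ?] ?].
by split; [apply/andP; split|apply/andP; split|]; nra.
Qed.

(** All vertices of the arcs, including the apex of an over-strand, lie in this convex
    set. *)
Lemma cell_box (R : realType) (N x y : R) T p : cell (flat_square N x y) T p ->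
  [/\ x <= p.1.1 <= x + 1, y <= p.1.2 <= y + 1 & N <= p.2].
Proof.
have mid s : [/\ x <= (midpoint (flat_square N x y) s).1.1 <= x + 1,
    y <= (midpoint (flat_square N x y) s).1.2 <= y + 1 &
    N <= (midpoint (flat_square N x y) s).2].
  by rewrite /flat_square; case: s; rewrite /midpoint sq_point3 /=;
    (split; [apply/andP; split|apply/andP; split|]); lra.
have ap : [/\ x <= (apex (flat_square N x y)).1.1 <= x + 1,
    y <= (apex (flat_square N x y)).1.2 <= y + 1 & N <= (apex (flat_square N x y)).2].
  by rewrite /flat_square /apex sq_point3 /=; split; [apply/andP; split|apply/andP; split|]; lra.
move=> [a _]; rewrite /arc_set; case: over_arc.
  by case=> h; exact: (segment_box h).
by move=> h; exact: (segment_box h).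
Qed.

Section WrapMosaic.
Variables (R : realType) (n : nat) (Mn : nat -> nat -> tile).
Hypothesis n1 : (0 < n)%N.
Hypothesis PC : planar_connected n Mn.
Local Notation N := (n%:R : R).
Local Notation rim := (rim n).
Local Notation wrap := (wrap N (slanted n Mn)).

Definition flat_cell (i j : nat) : set (R3 R) :=
  cell (flat_square N (i%:R - 1) (j%:R - 1)) (Mn i j).

Lemma N_ge1 : 1 <= N. Proof. by rewrite ler1n. Qed.
Local Notation N1 := N_ge1.

Lemma beyond_rim a : beyond N a = (rim a)%:R - 1.
Proof. by case: a; rewrite /= -?natr1; ring. Qed.

Lemma wall_end b : wall N b - outward b * (1/2) = (last_row n b)%:R - 1 + 1/2.
Proof. by case: b; rewrite /wall /outward /=; lra. Qed.

Lemma turnX_T0 a : turnX a T0 = T0. Proof. by case: a. Qed.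
Lemma turnY_T0 a : turnY a T0 = T0. Proof. by case: a. Qed.

Lemma last_row_itv b : (0 < last_row n b <= n)%N.
Proof. by case: b; rewrite /= ?n1 ?leqnn. Qed.

Lemma corner_connection a b :
  is_connection (Mn (rim a) (rim b)) (sideY (~~ b)) =
  is_connection (Mn (rim a) (last_row n b)) (sideY b).
Proof.
case: b => /=; last by rewrite (connected_U PC) //; case: a.
by rewrite (connected_U PC) //; case: a.
Qed.

Lemma flat_cell_corner a b : flat_cell (rim a) (rim b) =
  if is_connection (Mn (rim a) (last_row n b)) (sideY b) then corner_arc N a b else set0.
Proof.
have rm c : (rim c <= n.+1)%N by case: c.
rewrite /flat_cell (ring_tile_corner (boundaryX PC a (rm b)) (boundaryY PC b (rm a))).
rewrite corner_connection; case: ifP => _; last exact: cell_T0.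
by rewrite -!beyond_rim cell_corner_arc.
Qed.

Definition end_cell a b j : set (R3 R) :=
  if j == last_row n b then flat_cell (rim a) (rim b) else set0.

Lemma end_cellE a b j : end_cell a b j =
  if (j == last_row n b) && is_connection (Mn (rim a) j) (sideY b)
  then corner_arc N a b else set0.
Proof. by rewrite /end_cell flat_cell_corner; case: eqVneq => [->|]. Qed.

(** The corner tiles at the ends of a side x = 0 or x = N are absorbed by the last tiles
    of that side. *)
Lemma wrap_sideX a j : (0 < j <= n)%N ->
  wrap @` (flat_cell (rim a) j `|` end_cell a true j `|` end_cell a false j) =
  cell (steep_square N a (j%:R - 1)) (turnX a (Mn (rim a) j)).
Proof.
move=> /andP[j0 jn]; have jn1 : (j <= n.+1)%N by exact: leqW.
have lower : (j != 1%N) -> 2 <= j%:R :> R by move=> j1; rewrite ler_nat; lia.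
have upper : (j != n) -> j%:R + 1 <= N by move=> j1; rewrite natr1 ler_nat; lia.
have jN : j%:R <= N by rewrite ler_nat.
have j1 : 1 <= j%:R :> R by rewrite ler1n.
rewrite !end_cellE /flat_cell -beyond_rim.
case: (ring_tileX (boundaryX PC a jn1)) => [T|[b T]|T]; rewrite T.
- by rewrite turnX_T0 !cell_T0 !andbF !setU0 image_set0.
- rewrite cell_flat_arc cell_steep_arc.
  have conn b' : is_connection (tileX a b) (sideY b') = (b' == b) by case: a b b' {T} => -[] [].
  rewrite !conn -setUA (_ : _ `|` (if _ && (false == b) then _ else _) =
    if j == last_row n b then corner_arc N a b else set0); last first.
    by case: (b); rewrite ?andbT ?andbF ?setU0 ?set0U.
  have [jb|jb] := eqVneq j (last_row n b).
    have sl : slanted n Mn a b by rewrite /slanted -jb T; case: (a) (b) => -[].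
    by rewrite jb -wall_end wrap_flat_arc_end //; exact: N1.
  rewrite setU0 wrap_flat_arc_mid //; first exact: N1.
    by apply/andP; split; lra.
  by rewrite /outward; case: b {T conn} jb => /= jb; [have := upper jb|have := lower jb] => ?;
    apply/andP; split; lra.
- rewrite cell_flat_line cell_steep_line.
  have conn b' : is_connection T6 (sideY b') by case: b'.
  rewrite !conn !andbT.
  have sl b : j == last_row n b -> ~~ slanted n Mn a b by move/eqP => e; rewrite /slanted -e T.
  rewrite -(@wrap_flat_line _ _ (slanted n Mn) N1 a (j%:R - 1) (j == last_row n true) (j ==
    last_row n false)) //.
  + by case: eqVneq => /= [->|/upper ?]; lra.
  + by case: eqVneq => /= [->|/lower ?]; lra.
  + exact: sl.
  + exact: sl.
Qed.

(** Corner arcs are pushed into the planes x = 0 and x = N, so that the corners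
    contribute nothing on these sides. *)
Lemma wrap_sideY a i : (0 < i <= n)%N ->
  wrap @` flat_cell i (rim a) = cell (steep_square_y N a (i%:R - 1)) (turnY a (Mn i (rim a))).
Proof.
move=> /andP[j0 jn]; have jn1 : (i <= n.+1)%N by exact: leqW.
have jN : i%:R <= N by rewrite ler_nat.
have j1 : 1 <= i%:R :> R by rewrite ler1n.
rewrite /flat_cell -beyond_rim.
case: (ring_tileY (boundaryY PC a jn1)) => [T|[b T]|T]; rewrite T.
- by rewrite turnY_T0 !cell_T0 image_set0.
- rewrite cell_flat_arc_y cell_steep_arc_y wrap_flat_arc_end_y //; first exact: N1.
  by apply/andP; split; lra.
- rewrite cell_flat_line_y cell_steep_line_y wrap_flat_line_y //; first exact: N1.
  by apply/andP; split; lra.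
Qed.

Lemma wrap_inner i j : (0 < i <= n)%N -> (0 < j <= n)%N ->
  wrap @` flat_cell i j = flat_cell i j.
Proof.
move=> /andP[i0 i_n] /andP[j0 jn].
have i1 : 1 <= i%:R :> R by rewrite ler1n.
have iN : i%:R <= N by rewrite ler_nat.
have j1 : 1 <= j%:R :> R by rewrite ler1n.
have jN : j%:R <= N by rewrite ler_nat.
rewrite -[RHS]image_id; apply: eq_imagel => -[[x y] z] /cell_box /= [/andP[? ?] /andP[? ?] ?].
by rewrite (wrap_top _ N1) //; apply/andP; split; lra.
Qed.

Definition planar_to_cube (p : R3 R) : R3 R := wrap (p + (-1, -1, N)).

Lemma planar_to_cube_isotopic (A : set (R3 R)) :
  ambient_isotopic (in_S3 A) (in_S3 (planar_to_cube @` A)).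
Proof.
have -> : planar_to_cube @` A = wrap @` ((fun p => p + (-1, -1, N)) @` A) by rewrite image_comp.
exact: ambient_isotopic_trans (translate_isotopic _ _) (wrap_isotopic _ N1 _).
Qed.

Definition planar_tiles (q : 'I_n.+2 * 'I_n.+2) : tile := Mn q.1 q.2.
Definition cube_tiles (q : face * ('I_n * 'I_n)) : tile :=
  cube_tile n Mn (q.1, (val q.2.1, val q.2.2)).

Lemma planar_to_cube_cell (q : 'I_n.+2 * 'I_n.+2) :
  planar_to_cube @` cell (planar_square R q) (planar_tiles q) = wrap @` flat_cell q.1 q.2.
Proof.
rewrite /flat_cell -(image_comp _ wrap) cell_shift; congr (wrap @` cell _ _).
by rewrite /shift_square /planar_square /flat_square /=; congr Square;
  rewrite -[LHS]/(_ + -1, _ + -1, 0 + N) add0r.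
Qed.

Lemma planar_to_cube_cells :
  planar_to_cube @` mosaic_set (@planar_square R n.+2) planar_tiles =
  \bigcup_(ij in [set ij : nat * nat | (ij.1 < n.+2)%N && (ij.2 < n.+2)%N]) (wrap @` flat_cell
    ij.1 ij.2).
Proof.
rewrite mosaic_setE image_bigcup; apply/seteqP; split=> p.
  move=> [[i j] _]; rewrite planar_to_cube_cell => ?; exists (val i, val j) => //=.
  by rewrite !ltn_ord.
move=> [[i j] /= /andP[hi hj] hp]; exists (Ordinal hi, Ordinal hj) => //.
by rewrite planar_to_cube_cell.
Qed.

Definition cube_cell (q : face * ('I_n * 'I_n)) : set (R3 R) :=
  cell (cube_square R q) (cube_tiles q).

Lemma natrS_sub1 (j : nat) : j.+1%:R - 1 = j%:R :> R.
Proof. by rewrite -natr1 addrK. Qed.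

Lemma natr_last (j : nat) : j.+1 = n -> j%:R = N - 1 :> R.
Proof. by move=> <-; rewrite natrS_sub1. Qed.

Lemma last_lt : (n.-1 < n)%N. Proof. by rewrite ltn_predL. Qed.
Definition last_index : 'I_n := Ordinal last_lt.
Lemma last_index_last : (val last_index).+1 = n. Proof. by rewrite /= prednK. Qed.

Lemma cube_cell_Z1 (i j : 'I_n) : cube_cell (faceZ1, (i, j)) = flat_cell i.+1 j.+1.
Proof. by rewrite /cube_cell /flat_cell /cube_square /flat_square /= !natrS_sub1. Qed.

Lemma cube_cell_X1 (i j : 'I_n) : j.+1 = n ->
  cube_cell (faceX1, (i, j)) =
  cell (steep_square N true (i.+1%:R - 1)) (turnX true (Mn (rim true) i.+1)).
Proof.
move=> jn; rewrite /cube_cell /cube_square /steep_square /cube_tiles /=.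
by rewrite jn eqxx natrS_sub1 (natr_last jn).
Qed.

Lemma cube_cell_X0 (i j : 'I_n) : j.+1 = n ->
  cube_cell (faceX0, (j, i)) =
  cell (steep_square N false (i.+1%:R - 1)) (turnX false (Mn (rim false) i.+1)).
Proof.
move=> jn; rewrite /cube_cell /cube_square /steep_square /cube_tiles /=.
by rewrite jn eqxx natrS_sub1 (natr_last jn).
Qed.

Lemma cube_cell_Y1 (i j : 'I_n) : j.+1 = n ->
  cube_cell (faceY1, (j, i)) =
  cell (steep_square_y N true (i.+1%:R - 1)) (turnY true (Mn i.+1 (rim true))).
Proof.
move=> jn; rewrite /cube_cell /cube_square /steep_square_y /cube_tiles /=.
by rewrite jn eqxx natrS_sub1 (natr_last jn).
Qed.

Lemma cube_cell_Y0 (i j : 'I_n) : j.+1 = n ->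
  cube_cell (faceY0, (i, j)) =
  cell (steep_square_y N false (i.+1%:R - 1)) (turnY false (Mn i.+1 (rim false))).
Proof.
move=> jn; rewrite /cube_cell /cube_square /steep_square_y /cube_tiles /=.
by rewrite jn eqxx natrS_sub1 (natr_last jn).
Qed.

Local Notation wrapped_cells :=
  (\bigcup_(ij in [set ij : nat * nat | (ij.1 < n.+2)%N && (ij.2 < n.+2)%N]) (wrap @` flat_cell
    ij.1 ij.2)).

Lemma sub_wrapped i j : (i < n.+2)%N -> (j < n.+2)%N -> wrap @` flat_cell i j `<=` wrapped_cells.
Proof. by move=> hi hj p hp; exists (i, j) => //=; rewrite hi. Qed.

Lemma rim_lt a : (rim a < n.+2)%N. Proof. by case: a. Qed.

Lemma steep_sub a (j : 'I_n) :
  cell (steep_square N a (j.+1%:R - 1)) (turnX a (Mn (rim a) j.+1)) `<=` wrapped_cells.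
Proof.
have ln := ltn_ord j; have ja : (j.+1 < n.+2)%N by rewrite ltnS ltnW // ltnS ltnW.
rewrite -wrap_sideX // !image_setU => p [[hp|]|].
- exact: sub_wrapped (rim_lt a) ja _ hp.
- by rewrite /end_cell; case: ifP => _;
    [exact: sub_wrapped (rim_lt _) (rim_lt _) _|rewrite image_set0].
- by rewrite /end_cell; case: ifP => _;
    [exact: sub_wrapped (rim_lt _) (rim_lt _) _|rewrite image_set0].
Qed.

Lemma steep_sub_y a (j : 'I_n) :
  cell (steep_square_y N a (j.+1%:R - 1)) (turnY a (Mn j.+1 (rim a))) `<=` wrapped_cells.
Proof.
have ln := ltn_ord j; have ja : (j.+1 < n.+2)%N by rewrite ltnS ltnW // ltnS ltnW.
rewrite -wrap_sideY //; exact: sub_wrapped ja (rim_lt a).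
Qed.

Lemma cube_cell_sub q : cube_cell q `<=` wrapped_cells.
Proof.
case: q => f [i j]; have hi := ltn_ord i; have hj := ltn_ord j.
case: f.
- have [e|/negbTE ne] := eqVneq i.+1 n; first by rewrite cube_cell_X0 //; exact: steep_sub.
  by rewrite /cube_cell /cube_tiles /= ne cell_T0.
- have [e|/negbTE ne] := eqVneq j.+1 n; first by rewrite cube_cell_X1 //; exact: steep_sub.
  by rewrite /cube_cell /cube_tiles /= ne cell_T0.
- have [e|/negbTE ne] := eqVneq j.+1 n; first by rewrite cube_cell_Y0 //; exact: steep_sub_y.
  by rewrite /cube_cell /cube_tiles /= ne cell_T0.
- have [e|/negbTE ne] := eqVneq i.+1 n; first by rewrite cube_cell_Y1 //; exact: steep_sub_y.
  by rewrite /cube_cell /cube_tiles /= ne cell_T0.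
- by rewrite /cube_cell /cube_tiles cell_T0.
- by rewrite cube_cell_Z1 -wrap_inner //; apply: sub_wrapped; lia.
Qed.

Lemma sideX_sub a j : (0 < j <= n)%N ->
  wrap @` (flat_cell (rim a) j `|` end_cell a true j `|` end_cell a false j) `<=` \bigcup_q
    cube_cell q.
Proof.
case: j => // j /andP[_ jn]; rewrite wrap_sideX //.
case: a => p hp; [exists (faceX1, (Ordinal jn, last_index))|exists (faceX0, (last_index,
  Ordinal jn))] => //.
  by rewrite cube_cell_X1 // last_index_last.
by rewrite cube_cell_X0 // last_index_last.
Qed.

Lemma sideY_sub a j : (0 < j <= n)%N ->
  wrap @` flat_cell j (rim a) `<=` \bigcup_q cube_cell q.
Proof.
case: j => // j /andP[_ jn]; rewrite wrap_sideY //.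
case: a => p hp; [exists (faceY1, (last_index, Ordinal jn))|exists (faceY0, (Ordinal jn,
  last_index))] => //.
  by rewrite cube_cell_Y1 // last_index_last.
by rewrite cube_cell_Y0 // last_index_last.
Qed.

Lemma corner_sub a b : wrap @` flat_cell (rim a) (rim b) `<=` \bigcup_q cube_cell q.
Proof.
move=> p hp; apply: (@sideX_sub a (last_row n b) (last_row_itv b)).
rewrite !image_setU /end_cell; case: b hp => hp; [left; right|right]; by rewrite eqxx.
Qed.

Lemma rimP i : (i < n.+2)%N -> (exists a, i = rim a) \/ (0 < i <= n)%N.
Proof.
case: i => [|i]; first by left; exists false.
rewrite ltnS => i_n; have [->|ne] := eqVneq i n; first by left; exists true.
by right; lia.
Qed.

Lemma wrapped_cells_cube : wrapped_cells = \bigcup_q cube_cell q.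
Proof.
apply/seteqP; split; last by move=> p [q _]; exact: cube_cell_sub.
move=> p [[i j] /= /andP[/rimP hi /rimP hj]].
case: hi => [[a ->]|hi]; case: hj => [[b ->]|hj].
- exact: corner_sub.
- by move=> hp; apply: (sideX_sub hj); rewrite !image_setU; left; left; exact: hp.
- exact: sideY_sub.
- move=> hp; have {hp} : (wrap @` flat_cell i j) p by exact: hp.
  rewrite wrap_inner //; case: i j hi hj => [//|i] [//|j] /= hi hj hp.
  by exists (faceZ1, (Ordinal hi, Ordinal hj)); rewrite ?cube_cell_Z1.
Qed.

Lemma planar_to_cube_mosaic_set :
  planar_to_cube @` mosaic_set (@planar_square R n.+2) planar_tiles =
  mosaic_set (@cube_square R n) cube_tiles.
Proof. by rewrite planar_to_cube_cells wrapped_cells_cube mosaic_setE. Qed.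

Lemma planar_cube_isotopic :
  ambient_isotopic (in_S3 (mosaic_set (@planar_square R n.+2) planar_tiles))
    (in_S3 (mosaic_set (@cube_square R n) cube_tiles)).
Proof. by rewrite -planar_to_cube_mosaic_set; exact: planar_to_cube_isotopic. Qed.

End WrapMosaic.

(** * Connection points of the cube mosaic *)

Section HalfIntegers.
Variable R : realType.

(** Connection points have half-integral coordinates; doubling them turns all incidence
    questions into arithmetic on natural numbers. *)
Definition half_point (c : nat * nat * nat) : R3 R :=
  (c.1.1%:R / 2, c.1.2%:R / 2, c.2%:R / 2).

Lemma half_point_inj : injective half_point.
Proof.
have h (k l : nat) : k%:R / 2 = l%:R / 2 :> R -> k = l.
  move=> e; apply/eqP; rewrite -(eqr_nat R); apply/eqP; lra.
by move=> [[a b] c] [[a' b'] c'] [/h /= -> /h /= -> /h /= ->].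
Qed.

Definition planar_mid (i j : nat) (s : side) : nat * nat :=
  match s with
  | sideL => (2 * i, 2 * j + 1) | sideR => (2 * i + 2, 2 * j + 1)
  | sideU => (2 * i + 1, 2 * j + 2) | sideD => (2 * i + 1, 2 * j)
  end%N.

Definition cube_mid (n : nat) (f : face) (a b : nat) (s : side) : nat * nat * nat :=
  match f, s with
  | faceX0, sideL => (0, 2 * b + 1, 2 * a) | faceX0, sideR => (0, 2 * b + 1, 2 * a + 2)
  | faceX0, sideU => (0, 2 * b + 2, 2 * a + 1) | faceX0, sideD => (0, 2 * b, 2 * a + 1)
  | faceX1, sideL => (2 * n, 2 * a, 2 * b + 1) | faceX1, sideR => (2 * n, 2 * a + 2, 2 * b + 1)
  | faceX1, sideU => (2 * n, 2 * a + 1, 2 * b + 2) | faceX1, sideD => (2 * n, 2 * a + 1, 2 * b)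
  | faceY0, sideL => (2 * a, 0, 2 * b + 1) | faceY0, sideR => (2 * a + 2, 0, 2 * b + 1)
  | faceY0, sideU => (2 * a + 1, 0, 2 * b + 2) | faceY0, sideD => (2 * a + 1, 0, 2 * b)
  | faceY1, sideL => (2 * b + 1, 2 * n, 2 * a) | faceY1, sideR => (2 * b + 1, 2 * n, 2 * a + 2)
  | faceY1, sideU => (2 * b + 2, 2 * n, 2 * a + 1) | faceY1, sideD => (2 * b, 2 * n, 2 * a + 1)
  | faceZ0, sideL => (2 * b + 1, 2 * a, 0) | faceZ0, sideR => (2 * b + 1, 2 * a + 2, 0)
  | faceZ0, sideU => (2 * b + 2, 2 * a + 1, 0) | faceZ0, sideD => (2 * b, 2 * a + 1, 0)
  | faceZ1, sideL => (2 * a, 2 * b + 1, 2 * n) | faceZ1, sideR => (2 * a + 2, 2 * b + 1, 2 * n)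
  | faceZ1, sideU => (2 * a + 1, 2 * b + 2, 2 * n) | faceZ1, sideD => (2 * a + 1, 2 * b, 2 * n)
  end%N.

Ltac half_tac := rewrite /half_point /midpoint sq_point3 /=; congr (_, _, _);
  rewrite ?natrD ?natrM; lra.

Lemma planar_midpoint m (q : 'I_m * 'I_m) s :
  midpoint (planar_square R q) s = half_point (planar_mid q.1 q.2 s, 0%N).
Proof. by case: q => i j; rewrite /planar_square; case: s; half_tac. Qed.

Lemma cube_midpoint n (q : face * ('I_n * 'I_n)) s :
  midpoint (cube_square R q) s = half_point (cube_mid n q.1 q.2.1 q.2.2 s).
Proof. by case: q => f [a b]; rewrite /cube_square; case: f; case: s; half_tac. Qed.

End HalfIntegers.

Lemma planar_connectedP (R : realType) n (M : 'I_n.+2 * 'I_n.+2 -> tile) :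
  suitably_connected (@planar_square R n.+2) M ->
  no_boundary_connection (@planar_square R n.+2) M ->
  planar_connected n (fun i j => M (inord i, inord j)).
Proof.
move=> sc nb; split.
- move=> i j hi hj; apply: sc; first by apply/eqP => /(congr1 (fun q => nat_of_ord q.1)) /=;
    rewrite !inordK //=; lia.
  by rewrite !planar_midpoint; congr half_point; rewrite /= !inordK //; (try congr (_, _, _));
    lia.
- move=> i j hi hj; apply: sc; first by apply/eqP => /(congr1 (fun q => nat_of_ord q.2)) /=;
    rewrite !inordK //=; lia.
  by rewrite !planar_midpoint; congr half_point; rewrite /= !inordK //; (try congr (_, _, _));
    lia.
- move=> a j hj; apply: nb => -[k l] t; have := ltn_ord k; have := ltn_ord l => ll lk.
  rewrite !planar_midpoint; apply: contra_neq => /half_point_inj /=.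
  by case: a => /=; rewrite !inordK //; case: t => /= -[e1 e2]; try lia;
    congr (_, _); apply/ord_inj; rewrite inordK //; lia.
- move=> a j hj; apply: nb => -[k l] t; have := ltn_ord k; have := ltn_ord l => ll lk.
  rewrite !planar_midpoint; apply: contra_neq => /half_point_inj /=.
  by case: a => /=; rewrite !inordK //; case: t => /= -[e1 e2]; try lia;
    congr (_, _); apply/ord_inj; rewrite inordK //; lia.
Qed.

Section Transfer.
Variables (n : nat) (Mn : nat -> nat -> tile).
Hypothesis n1 : (0 < n)%N.
Hypothesis PC : planar_connected n Mn.
Local Notation rim := (rim n).

(** Whether a doubled point of the cube is a connection point, read off the planar
    mosaic at a point which is folded onto it.  Since this depends on the point alone,
    squares sharing a side agree there. *)
Definition cube_connection (c : nat * nat * nat) : bool :=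
  let: (x, y, z) := c in
  if z == (2 * n)%N then
    is_connection (Mn x./2.+1 y./2.+1) (if odd x then sideD else sideL)
  else if z.+1 == (2 * n)%N then
    if x == (2 * n)%N then is_connection (Mn n.+1 y./2.+1) sideD
    else if x == 0%N then is_connection (Mn 0 y./2.+1) sideD
    else if y == (2 * n)%N then is_connection (Mn x./2.+1 n.+1) sideL
    else if y == 0%N then is_connection (Mn x./2.+1 0) sideL
    else false
  else false.

Ltac split_ifs := repeat (case: ifP => ?; [try (exfalso; lia)|try (exfalso; lia)]); rewrite //.

(** The only delicate points are the midpoints of the vertical edges: such a point comes
    from both ends of a corner arc, and [corner_tile_sym] says that these agree. *)
Lemma cube_connectionE f a b s : (a < n)%N -> (b < n)%N ->
  is_connection (cube_tile n Mn (f, (a, b))) s = cube_connection (cube_mid n f a b s).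
Proof.
move=> an bn.
have d0 k : (2 * k)./2 = k by lia.
have d1 k : (2 * k + 1)./2 = k by lia.
have d2 k : (2 * k + 2)./2 = k.+1 by lia.
have o0 k : odd (2 * k) = false by lia.
have o1 k : odd (2 * k + 1) by lia.
have o2 k : odd (2 * k + 2) = false by lia.
have cs a' b' : is_connection (Mn (rim a') (rim b')) (sideY (~~ b')) =
    is_connection (Mn (rim a') (rim b')) (sideX (~~ a')).
  by apply: corner_tile_sym; [apply: (boundaryX PC)|apply: (boundaryY PC)];
    [case: (b')|case: (a')].
have bX a' j : (j <= n.+1)%N -> is_connection (Mn (rim a') j) (sideX a') = false.
  by move=> hj; apply/negbTE; exact: (boundaryX PC).
have bY a' j : (j <= n.+1)%N -> is_connection (Mn j (rim a')) (sideY a') = false.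
  by move=> hj; apply/negbTE; exact: (boundaryY PC).
have cR := connected_R PC; have cU := connected_U PC.
have hX1 T : is_connection T sideR = false ->
  [/\ is_connection (turnX1 T) sideL = is_connection T sideD,
      is_connection (turnX1 T) sideR = is_connection T sideU,
      is_connection (turnX1 T) sideU = is_connection T sideL &
      is_connection (turnX1 T) sideD = false] by case: T.
have hY1 T : is_connection T sideU = false ->
  [/\ is_connection (turnY1 T) sideD = is_connection T sideL,
      is_connection (turnY1 T) sideU = is_connection T sideR,
      is_connection (turnY1 T) sideR = is_connection T sideD &
      is_connection (turnY1 T) sideL = false] by case: T.
have T0s t : is_connection T0 t = false by [].
have an1 : (a.+1 <= n.+1)%N by lia.
have bn1 : (b.+1 <= n.+1)%N by lia.
case: f => /=.
- have [e|/eqP ne] := eqVneq a.+1 n; last first.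
    by rewrite T0s /cube_connection; case: s => /=; split_ifs.
  have := bX false _ bn1; rewrite /= => bXb.
  case: s; rewrite /cube_connection ?(d0, d1, d2, o0, o1, o2) ?bXb; clear bXb; split_ifs.
  + by rewrite /= cR //; lia.
  + by rewrite cU //; lia.
- have [e|/eqP ne] := eqVneq b.+1 n; last first.
    by rewrite T0s /cube_connection; case: s => /=; split_ifs.
  have := bX true _ an1; rewrite /= => /hX1[hL hR hU hD].
  case: s; rewrite /cube_connection ?(d0, d1, d2, o0, o1, o2) ?(hL, hR, hU, hD);
    clear hL hR hU hD; split_ifs.
  + by rewrite cU //; lia.
- have [e|/eqP ne] := eqVneq b.+1 n; last first.
    by rewrite T0s /cube_connection; case: s => /=; split_ifs.
  have := bY false _ an1; rewrite /= => bYa.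
  case: s; rewrite /cube_connection ?(d0, d1, d2, o0, o1, o2) ?bYa; clear bYa; split_ifs.
  + have -> : a = 0%N by lia.
    by have := cs false false; rewrite /= -cR // => <-; rewrite cU.
  + have -> : a = n.-1 by lia.
    by have := cs true false; rewrite /= prednK // cR // => <-; rewrite cU.
  + by rewrite cR //; lia.
  + by rewrite cU //; lia.
- have [e|/eqP ne] := eqVneq a.+1 n; last first.
    by rewrite T0s /cube_connection; case: s => /=; split_ifs.
  have := bY true _ bn1; rewrite /= => /hY1[hL hR hU hD].
  case: s; rewrite /cube_connection ?(d0, d1, d2, o0, o1, o2) ?(hL, hR, hU, hD);
    clear hL hR hU hD; split_ifs.
  + have -> : b = n.-1 by lia.
    by have := cs true true; rewrite /= prednK // cR // => <-; rewrite ?d0.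
  + by rewrite cR //; lia.
  + have -> : b = 0%N by lia.
    by have := cs false true; rewrite /= ?d0 => ->; rewrite cR.
- by rewrite T0s /cube_connection; case: s => /=; split_ifs.
- case: s; rewrite /cube_connection ?(d0, d1, d2, o0, o1, o2); split_ifs.
  + by rewrite cR //; lia.
  + by rewrite cU //; lia.
Qed.

Lemma cube_suitably_connected (R : realType) :
  suitably_connected (@cube_square R n) (@cube_tiles n Mn).
Proof.
move=> [f [a b]] [g [c d]] s t _; rewrite !cube_midpoint => /half_point_inj /= e.
by rewrite /cube_tiles !cube_connectionE ?ltn_ord //; congr cube_connection.
Qed.

(** The wrapping map on doubled connection points, with the planar grid shifted by (-1,
    -1). *)
Definition wrap_vertex (c : nat * nat) : nat * nat * nat :=
  (minn (c.1 - 2) (2 * n), minn (c.2 - 2) (2 * n),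
   2 * n - ((c.1 == 1) + (c.1 == 2 * n + 3) + (c.2 == 1) + (c.2 == 2 * n + 3)))%N.

(** The square (a, b) of the face f carries the tile (i, j), up to a rotation of its
    sides which is compatible with the wrapping of connection points.  Arcs are matched
    up to orientation. *)
Definition chart (i j : nat) (f : face) (a b : nat) : Prop :=
  exists turn : side -> side,
  [/\ forall s, is_connection (Mn i j) s ->
        wrap_vertex (planar_mid i j s) = cube_mid n f a b (turn s),
      forall s t, (s, t) \in tile_arcs (Mn i j) ->
        (turn s, turn t) \in tile_arcs (cube_tile n Mn (f, (a, b))) \/
        (turn t, turn s) \in tile_arcs (cube_tile n Mn (f, (a, b))) &
      forall s' t', (s', t') \in tile_arcs (cube_tile n Mn (f, (a, b))) ->
        exists s t, (s, t) \in tile_arcs (Mn i j) /\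
          ((s', t') = (turn s, turn t) \/ (s', t') = (turn t, turn s))].

Lemma chart_id i j f a b : cube_tile n Mn (f, (a, b)) = Mn i j ->
  (forall s, is_connection (Mn i j) s -> wrap_vertex (planar_mid i j s) = cube_mid n f a b s) ->
  chart i j f a b.
Proof.
move=> e h; exists id; split=> //; rewrite e => s t st; first by left.
by exists s, t; split=> //; left.
Qed.

Ltac mid_tac := rewrite /wrap_vertex /planar_mid /cube_mid /=; congr (_, _, _); lia.

Lemma chart_Z1 i j : (i < n)%N -> (j < n)%N -> chart i.+1 j.+1 faceZ1 i j.
Proof. by move=> hi hj; apply: chart_id => // -[] _; mid_tac. Qed.

Lemma chart_X0 j k : (j < n)%N -> k.+1 = n -> chart 0 j.+1 faceX0 k j.
Proof.
move=> hj hk; apply: chart_id; first by rewrite /= hk eqxx.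
have := @boundaryX _ _ PC false j.+1; rewrite /= => /(_ _)/negbTE bl.
case; rewrite ?bl //; try lia; clear bl => _; mid_tac.
Qed.

Lemma chart_Y0 i k : (i < n)%N -> k.+1 = n -> chart i.+1 0 faceY0 i k.
Proof.
move=> hi hk; apply: chart_id; first by rewrite /= hk eqxx.
have := @boundaryY _ _ PC false i.+1; rewrite /= => /(_ _)/negbTE bl.
case; rewrite ?bl //; try lia; clear bl => _; mid_tac.
Qed.

Lemma chart_X1 j k : (j < n)%N -> k.+1 = n -> chart n.+1 j.+1 faceX1 j k.
Proof.
move=> hj hk; have := @boundaryX _ _ PC true j.+1; rewrite /= => /(_ _)/negbTE bl.
have {}bl : is_connection (Mn n.+1 j.+1) sideR = false by apply: bl; lia.
exists (fun s => match s with sideL => sideU | sideU => sideR | sideR => sideD | sideD => sideL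
  end).
rewrite /chart /= hk eqxx; split.
- by case; rewrite ?bl //; clear bl => _; mid_tac.
- by case: (Mn n.+1 j.+1) bl => //= _ s t; rewrite !inE => /eqP [-> ->]; auto.
- by case: (Mn n.+1 j.+1) bl => //= _ s t; rewrite !inE => /eqP [-> ->];
    do 2 eexists; (split; [rewrite inE; apply/eqP; reflexivity|auto]).
Qed.

Lemma chart_Y1 i k : (i < n)%N -> k.+1 = n -> chart i.+1 n.+1 faceY1 k i.
Proof.
move=> hi hk; have := @boundaryY _ _ PC true i.+1; rewrite /= => /(_ _)/negbTE bl.
have {}bl : is_connection (Mn i.+1 n.+1) sideU = false by apply: bl; lia.
exists (fun s => match s with sideL => sideD | sideD => sideR | sideR => sideU | sideU => sideL
  end).
rewrite /chart /= hk eqxx; split.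
- by case; rewrite ?bl //; clear bl => _; mid_tac.
- by case: (Mn i.+1 n.+1) bl => //= _ s t; rewrite !inE => /eqP [-> ->]; auto.
- by case: (Mn i.+1 n.+1) bl => //= _ s t; rewrite !inE => /eqP [-> ->];
    do 2 eexists; (split; [rewrite inE; apply/eqP; reflexivity|auto]).
Qed.

Lemma chart_of_planar i j : (i < n.+2)%N -> (j < n.+2)%N ->
  (exists a b, i = rim a /\ j = rim b) \/
  (exists f (a b : 'I_n), chart i j f a b).
Proof.
move=> hi hj; pose l := last_index n1; have le := last_index_last n1.
case: (rimP n1 hi) => [[a ->]|/andP[i0 i_n]]; case: (rimP n1 hj) => [[b ->]|/andP[j0 j_n]].
- by left; exists a, b.
- right; case: j hj j0 j_n => // j _ _ jn.
  case: a; [exists faceX1, (Ordinal jn), l|exists faceX0, l, (Ordinal jn)].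
    exact: chart_X1.
  exact: chart_X0.
- right; case: i hi i0 i_n => // i _ _ i_n.
  case: b; [exists faceY1, l, (Ordinal i_n)|exists faceY0, (Ordinal i_n), l].
    exact: chart_Y1.
  exact: chart_Y0.
- right; case: i hi i0 i_n => // i _ _ i_n; case: j hj j0 j_n => // j _ _ jn.
  by exists faceZ1, (Ordinal i_n), (Ordinal jn); exact: chart_Z1.
Qed.

Lemma chart_of_cube f (a b : 'I_n) : cube_tile n Mn (f, (val a, val b)) <> T0 ->
  exists i j, [/\ (i < n.+2)%N, (j < n.+2)%N & chart i j f a b].
Proof.
have ha := ltn_ord a; have hb := ltn_ord b.
case: f => //=.
- case: eqVneq => // e _; exists 0%N, b.+1; split=> //; [lia|exact: chart_X0].
- case: eqVneq => // e _; exists n.+1, a.+1; split=> //; [lia|exact: chart_X1].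
- case: eqVneq => // e _; exists a.+1, 0%N; split=> //; [lia|exact: chart_Y0].
- case: eqVneq => // e _; exists b.+1, n.+1; split=> //; [lia|exact: chart_Y1].
- by move=> _; exists a.+1, b.+1; split; [lia|lia|exact: chart_Z1].
Qed.

(** This is why corner tiles can be dropped without cutting the curve. *)
Lemma corner_mid a b s t : (s, t) \in tile_arcs (Mn (rim a) (rim b)) ->
  wrap_vertex (planar_mid (rim a) (rim b) s) = wrap_vertex (planar_mid (rim a) (rim b) t).
Proof.
have := @boundaryX _ _ PC a (rim b); have := @boundaryY _ _ PC b (rim a).
have rm c : (rim c <= n.+1)%N by case: c.
move=> /(_ (rm _)) bY /(_ (rm _)) bX.
rewrite (ring_tile_corner bX bY); case: ifP => // _.
by case: a b {bX bY} => -[] /=; rewrite inE => /eqP[-> ->]; mid_tac.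
Qed.

End Transfer.

(** * The curve of the cube mosaic *)

Lemma connect_elim (T : finType) (e : rel T) (P : T -> Prop) (x : T) :
  P x -> (forall y z, P y -> e y z -> P z) -> forall y, connect e x y -> P y.
Proof.
move=> Px Pe y /connectP[p + ->]; elim: p x Px => //= z p IH x Px /andP[xz zp].
by apply: IH zp; apply: Pe xz.
Qed.

Section ClosedCurve.
Variables (R : realType) (n : nat) (Mn : nat -> nat -> tile).
Hypothesis n1 : (0 < n)%N.
Hypothesis PC : planar_connected n Mn.
Local Notation rim := (rim n).
Local Notation planar_arc := (('I_n.+2 * 'I_n.+2) * (side * side))%type.
Local Notation cube_arc := ((face * ('I_n * 'I_n)) * (side * side))%type.
Local Notation planarM := (@planar_tiles n Mn).
Local Notation cubeM := (@cube_tiles n Mn).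

Definition planar_ends (x : planar_arc) : seq (nat * nat) :=
  [:: planar_mid x.1.1 x.1.2 x.2.1; planar_mid x.1.1 x.1.2 x.2.2].
Definition cube_ends (u : cube_arc) : seq (nat * nat * nat) :=
  [:: cube_mid n u.1.1 u.1.2.1 u.1.2.2 u.2.1; cube_mid n u.1.1 u.1.2.1 u.1.2.2 u.2.2].

Lemma cube_linked u v c : is_arc cubeM u -> is_arc cubeM v ->
  c \in cube_ends u -> c \in cube_ends v -> linked (@cube_square R n) cubeM u v.
Proof.
have E w : endpoints (@cube_square R n) w = map (@half_point R) (cube_ends w).
  by rewrite /endpoints !cube_midpoint.
by move=> au av cu cv; rewrite /linked au av !E; apply/hasP; exists (half_point R c);
  [|rewrite inE]; exact: map_f.
Qed.

Lemma planar_linked x y : linked (@planar_square R n.+2) planarM x y ->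
  [/\ is_arc planarM x, is_arc planarM y &
    exists2 c, c \in planar_ends x & c \in planar_ends y].
Proof.
have E w : endpoints (@planar_square R n.+2) w =
    map (fun c => half_point R (c, 0%N)) (planar_ends w).
  by rewrite /endpoints !planar_midpoint.
move=> /and3P[ax ay]; rewrite !E => /hasP[_ /mapP[c cy ->]].
rewrite inE => /mapP[d dx /half_point_inj [/= e]]; split=> //.
by exists c => //; case: c d e dx {cy} => [c1 c2] [d1 d2] /= [-> ->].
Qed.

Lemma arc_connection T s t : (s, t) \in tile_arcs T ->
  is_connection T s /\ is_connection T t.
Proof.
by move=> st; split; apply/hasP; exists (s, t) => //=; rewrite eqxx ?orbT.
Qed.

Lemma arc_to_cube (x : planar_arc) : is_arc planarM x ->
  (exists a b, [/\ x.1.1 = rim a :> nat, x.1.2 = rim b :> nat &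
    forall c d, c \in planar_ends x -> d \in planar_ends x -> wrap_vertex n c = wrap_vertex n
      d]) \/
  (exists2 u, is_arc cubeM u & cube_ends u =i map (wrap_vertex n) (planar_ends x)).
Proof.
case: x => [[i j] [s t]] ax.
have [[a [b [ia jb]]]|[f [a [b [turn [hmid harc _]]]]]] := chart_of_planar n1 PC (ltn_ord i)
  (ltn_ord j).
  left; exists a, b; split=> //.
  have : wrap_vertex n (planar_mid i j s) = wrap_vertex n (planar_mid i j t).
    by move: ax; rewrite /is_arc /planar_tiles /= ia jb => /(corner_mid n1 PC).
  by move=> e c d; rewrite !inE => /orP[] /eqP -> /orP[] /eqP ->.
right; have [cs ct] := arc_connection ax.
have [h|h] := harc _ _ ax.
  exists ((f, (a, b)), (turn s, turn t)) => // c.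
  by rewrite /cube_ends /planar_ends /= !hmid.
exists ((f, (a, b)), (turn t, turn s)) => // c.
by rewrite /cube_ends /planar_ends /= !hmid // !inE orbC.
Qed.

Lemma arc_of_cube (u : cube_arc) : is_arc cubeM u ->
  exists2 x, is_arc planarM x & cube_ends u =i map (wrap_vertex n) (planar_ends x).
Proof.
case: u => [[f [a b]] [s t]] au.
have nz : cube_tile n Mn (f, (val a, val b)) <> T0.
  move=> e; have : (s, t) \in tile_arcs (cube_tile n Mn (f, (val a, val b))) by exact: au.
  by rewrite e.
have [i [j [hi hj [turn [hmid _ hback]]]]] := chart_of_cube n1 PC nz.
have [s' [t' [st e]]] := hback _ _ au; have [cs ct] := arc_connection st.
exists ((Ordinal hi, Ordinal hj), (s', t')) => // c.
rewrite /cube_ends /planar_ends /= !hmid //.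
by case: e => -[-> ->] //; rewrite !inE orbC.
Qed.

(** A chain of linked planar arcs is followed on the cube.  A noncorner arc has a
    counterpart with the images of its endpoints; a corner arc collapses to one point,
    so that whatever touches its image already touches the image of the preceding arc. *)
Lemma cube_single_closed_curve :
  single_closed_curve (@planar_square R n.+2) planarM ->
  single_closed_curve (@cube_square R n) cubeM.
Proof.
move=> [[x ax] conn]; split.
  (* If the given arc lies in a corner, then the neighbouring tile of the side of the ring
     has an arc too. *)
  case: (arc_to_cube ax) => [[a [b [xa xb _]]]|[u au _]]; last by exists u.
  have cx : is_connection (Mn (rim a) (last_row n b)) (sideY b).
    rewrite -(corner_connection PC); have rm c : (rim c <= n.+1)%N by case: c.
    have := ring_tile_corner (boundaryX PC a (rm b)) (boundaryY PC b (rm a)).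
    case: ifP => // _ T0x; move: ax; rewrite /is_arc /planar_tiles xa xb T0x.
    by [].
  have /hasP[[s t] st _] := cx; have /andP[l0 ln] := last_row_itv n1 b.
  have lb : (last_row n b < n.+2)%N by rewrite ltnS ltnW.
  pose y : planar_arc := ((Ordinal (rim_lt n a), Ordinal lb), (s, t)).
  have [[a' [b' [_ + _]]]|[u au _]] := @arc_to_cube y st; last by exists u.
  by case: b' => /= e; exfalso; lia.
move=> u v au av.
have [x0 ax0 ux0] := arc_of_cube au; have [y ay vy] := arc_of_cube av.
pose P z := is_arc planarM z /\ forall w, is_arc cubeM w ->
  (exists2 d, d \in planar_ends z & wrap_vertex n d \in cube_ends w) ->
  connect (linked (@cube_square R n) cubeM) u w.
have : P y.
  apply: (@connect_elim _ _ P x0 _ _ y (conn x0 y ax0 ay)).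
    split=> // w aw [d dx dw]; apply: connect1; apply: (cube_linked (c := wrap_vertex n d)) => //.
    by rewrite ux0 map_f.
  move=> z z' [az Pz] /planar_linked[_ az' [c cz cz']]; split=> // w aw [d dz' dw].
  have [[a [b [_ _ he]]]|[w' aw' ew']] := arc_to_cube az'.
    by apply: Pz => //; exists c => //; rewrite (he c d).
  apply: (@connect_trans _ _ w').
    by apply: Pz => //; exists c => //; rewrite ew' map_f.
  apply: connect1; apply: (cube_linked (c := wrap_vertex n d)) => //.
  by rewrite ew' map_f.
move=> [_]; apply=> //; exists (planar_mid y.1.1 y.1.2 y.2.1); first by rewrite inE eqxx.
by rewrite vy map_f // inE eqxx.
Qed.

End ClosedCurve.

(** * Stretching a diamond into a circle *)

Section Round.
Variable R : realType.
Implicit Types (r d : R -> R) (P : R -> Prop).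

Definition graph_y P r : set (R3 R) :=
  [set p | [/\ P p.1.1, `|p.1.2| = r p.1.1 & p.2 = 0]].
Definition graph_x P r : set (R3 R) :=
  [set p | [/\ P p.1.2, `|p.1.1| = r p.1.2 & p.2 = 0]].

(** Added to y, this moves y away from 0 by d, as soon as |y| >= d. *)
Definition stretch (d y : R) := Num.max (- d) (Num.min d y).

Lemma stretch_slope (d y y' : R) : 0 <= d -> y < y' -> y + stretch d y < y' + stretch d y'.
Proof. by rewrite /stretch => d0 yy'; minmax. Qed.

Lemma stretch_bound (d y : R) : 0 <= d -> `|stretch d y| <= d.
Proof. by rewrite /stretch => d0; rewrite ler_norml; apply/andP; split; minmax. Qed.

Lemma stretch_norm (d y : R) : 0 <= d <= `|y| -> `|y + stretch d y| = `|y| + d.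
Proof.
move=> /andP[d0]; rewrite /stretch; case: (ger0P y) => y0 dy.
  rewrite (min_l dy) max_r; last lra.
  by rewrite ger0_norm //; lra.
rewrite min_r ?max_l; [|lra..].
by rewrite ler0_norm; lra.
Qed.

Lemma stretch_surj (d r y : R) : 0 <= d <= r -> `|y| = r + d ->
  exists2 y', `|y'| = r & y' + stretch d y' = y.
Proof.
move=> /andP[d0 dr]; case: (ger0P y) => y0 ye.
  exists r; first by rewrite ger0_norm //; lra.
  by rewrite /stretch (min_l dr) max_r; lra.
exists (- r); first by rewrite normrN ger0_norm //; lra.
by rewrite /stretch min_r ?max_l; lra.
Qed.

Lemma stretch_y_isotopic P r d C : continuous d -> (forall x, 0 <= d x <= C) ->
  (forall x, P x -> d x <= r x) ->
  ambient_isotopic (in_S3 (graph_y P r)) (in_S3 (graph_y P (fun x => r x + d x))).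
Proof.
move=> dc dC dr; have d0 x : 0 <= d x by have /andP[] := dC x.
pose h (p : R3 R) := stretch (d p.1.1) p.1.2.
have -> : graph_y P (fun x => r x + d x) =
    (fun p => (p.1.1, p.1.2 + h p, p.2)) @` graph_y P r.
  apply/seteqP; split=> [[[x y] z]|_ [[[x y] z]] /= [Px yr z0] <-] /=.
    move=> [/= Px yr z0].
    have [|y' y'r y'E] := stretch_surj _ yr; first by rewrite d0 dr.
    by exists (x, y', z) => //=; rewrite /h /= y'E.
  by split=> //=; rewrite /h /= stretch_norm yr // d0 dr.
have cc : continuous (fun p : R3 R => p.1.1) by continuity.
have dc1 : continuous (fun p : R3 R => d p.1.1).
  by move=> p; apply: (@cvg_comp _ _ _ (fun p : R3 R => p.1.1) d _ (nbhs p.1.1));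
    [exact: cc|exact: dc].
apply: (@shift_y_isotopic _ h C).
- rewrite /h /stretch; apply: cont_max; first exact: contN.
  by apply: cont_min => //; continuity.
- by move=> p; apply: le_trans (stretch_bound _ (d0 _)) _; have /andP[] := dC p.1.1.
- by move=> x y y' z yy'; exact: stretch_slope.
Qed.

Lemma stretch_x_isotopic P r d C : continuous d -> (forall y, 0 <= d y <= C) ->
  (forall y, P y -> d y <= r y) ->
  ambient_isotopic (in_S3 (graph_x P r)) (in_S3 (graph_x P (fun y => r y + d y))).
Proof.
move=> dc dC dr; have d0 x : 0 <= d x by have /andP[] := dC x.
pose h (p : R3 R) := stretch (d p.1.2) p.1.1.
have -> : graph_x P (fun x => r x + d x) =
    (fun p => (p.1.1 + h p, p.1.2, p.2)) @` graph_x P r.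
  apply/seteqP; split=> [[[x y] z]|_ [[[x y] z]] /= [Px yr z0] <-] /=.
    move=> [/= Px yr z0].
    have [|y' y'r y'E] := stretch_surj _ yr; first by rewrite d0 dr.
    by exists (y', y, z) => //=; rewrite /h /= y'E.
  by split=> //=; rewrite /h /= stretch_norm yr // d0 dr.
have cc : continuous (fun p : R3 R => p.1.2) by continuity.
have dc1 : continuous (fun p : R3 R => d p.1.2).
  by move=> p; apply: (@cvg_comp _ _ _ (fun p : R3 R => p.1.2) d _ (nbhs p.1.2));
    [exact: cc|exact: dc].
apply: (@shift_x_isotopic _ h C).
- rewrite /h /stretch; apply: cont_max; first exact: contN.
  by apply: cont_min => //; continuity.
- by move=> p; apply: le_trans (stretch_bound _ (d0 _)) _; have /andP[] := dC p.1.2.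
- by move=> x x' y z yy'; exact: stretch_slope.
Qed.

Definition diamond : set (R3 R) := [set p | `|p.1.1| + `|p.1.2| = 1/2 /\ p.2 = 0].
Definition height (x : R) := Num.sqrt (1 - x ^+ 2).

Lemma height_ge0 x : 0 <= height x. Proof. exact: sqrtr_ge0. Qed.

Lemma height_le1 x : height x <= 1.
Proof.
rewrite -[leRHS]sqrtr1; apply: ler_wsqrtr.
by have := sqr_ge0 x; lra.
Qed.

Lemma height_norm x : height `|x| = height x.
Proof. by rewrite /height real_normK // num_real. Qed.

Lemma heightP (u v : R) : 0 <= u <= 1 -> 0 <= v ->
  (v = height u <-> u ^+ 2 + v ^+ 2 = 1) /\ (v <= height u <-> u ^+ 2 + v ^+ 2 <= 1).
Proof.
move=> /andP[u0 u1] v0; have hu : 0 <= 1 - u ^+ 2 by rewrite subr_ge0 expr_le1.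
have le : v <= height u <-> u ^+ 2 + v ^+ 2 <= 1.
  rewrite -(ler_pXn2r (_ : (0 < 2)%N)) // ?nnegrE ?height_ge0 // sqr_sqrtr //.
  by split; lra.
split=> //; split=> [->|e]; first by rewrite sqr_sqrtr //; lra.
by rewrite /height (_ : 1 - u ^+ 2 = v ^+ 2); [rewrite sqrtr_sqr ger0_norm|lra].
Qed.

Lemma min_eq (a b v : R) : v = Num.min a b <-> (v = a /\ v <= b) \/ (v = b /\ v <= a).
Proof.
split=> [->|[[-> ?]|[-> ?]]]; [|by rewrite min_l|by rewrite min_r].
by case: (leP a b) => h; [left|right]; split=> //; exact: ltW.
Qed.

(** Both sides describe, in the first quadrant, the boundary of the part of the unit
    disc below the chord from (3/5, 4/5) to (1, 0), once as a graph over u and once as a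
    graph over v. *)
Lemma chord_sym (u v : R) : 0 <= u -> 0 <= v ->
  (u <= 1 /\ v = Num.min (height u) (2 * (1 - u))) <->
  (v <= 1 /\ u = Num.min (height v) (1 - v / 2)).
Proof.
move=> u0 v0; rewrite !min_eq.
have sq (w w' : R) : 0 <= w -> w ^+ 2 + w' ^+ 2 <= 1 -> w <= 1.
  move=> w0 h; rewrite -(expr_le1 (_ : (0 < 2)%N)) //.
  by have := sqr_ge0 w'; lra.
split=> -[h1 h].
  have [hE hle] : (v = height u <-> u ^+ 2 + v ^+ 2 = 1)
    /\ (v <= height u <-> u ^+ 2 + v ^+ 2 <= 1).
    by apply: heightP; rewrite ?u0.
  rewrite hE hle in h.
  have v1 : v <= 1 by apply: (sq _ u) => //; case: h; lra.
  have [-> ->] : (u = height v <-> v ^+ 2 + u ^+ 2 = 1)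
    /\ (u <= height v <-> v ^+ 2 + u ^+ 2 <= 1).
    by apply: heightP; rewrite ?v0.
  by split=> //; case: h => -[? ?]; [left|right]; split; lra.
have [hE hle] : (u = height v <-> v ^+ 2 + u ^+ 2 = 1)
  /\ (u <= height v <-> v ^+ 2 + u ^+ 2 <= 1).
  by apply: heightP; rewrite ?v0.
rewrite hE hle in h.
have u1 : u <= 1 by apply: (sq _ v) => //; case: h; lra.
have [-> ->] : (v = height u <-> u ^+ 2 + v ^+ 2 = 1) /\ (v <= height u <-> u ^+ 2 + v ^+ 2 <= 1).
  by apply: heightP; rewrite ?u0.
by split=> //; case: h => -[? ?]; [left|right]; split; lra.
Qed.

Lemma graph_y_eq P r r' : (forall x, P x -> r x = r' x) -> graph_y P r = graph_y P r'.
Proof. by move=> h; apply/seteqP; split=> p [Pp pr pz]; split=> //; rewrite pr h. Qed.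

(** A single stretch in the direction of y cannot produce the circle, whose tangents at
    (1, 0) and (-1, 0) are vertical.  The diamond is doubled in size, then stretched in
    the direction of y into the circle truncated by the chords from (3/5, 4/5) to (1, 0)
    and their mirror images, and the missing caps are filled by a stretch in the
    direction of x. *)
Lemma diamond_unknot : ambient_isotopic (in_S3 diamond) (unknot_image R).
Proof.
have -> : diamond = graph_x (fun y => `|y| <= 1/2) (fun y => 1/2 - `|y|).
  apply/seteqP; split=> p [].
    by move=> e z0; have := normr_ge0 p.1.1; split=> //; lra.
  by move=> h e z0; split=> //; lra.
apply: (@ambient_isotopic_trans _ _ (in_S3 (graph_y (fun x => `|x| <= 1) (fun x => (1 - `|x|) /
  2)))).
  have -> : graph_y (fun x => `|x| <= 1) (fun x => (1 - `|x|) / 2) =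
      graph_x (fun y => `|y| <= 1/2) (fun y => 1/2 - `|y| + Num.max 0 (1/2 - `|y|)).
    apply/seteqP; split=> p [h e z0].
      by have := normr_ge0 p.1.1; split=> //; [lra|rewrite max_r; lra].
    by move: e; rewrite max_r; [|lra]; have := normr_ge0 p.1.2; split=> //; lra.
  apply: (@stretch_x_isotopic _ _ _ (1/2)).
  - by continuity.
  - by move=> y; have := normr_ge0 y; move: `|y| => u u0; apply/andP; split; minmax.
  - by move=> y hy; rewrite max_r; lra.
apply: (@ambient_isotopic_trans _ _ (in_S3 (graph_y (fun x => `|x| <= 1) (fun x => 1 - `|x|)))).
  have -> : graph_y (fun x => `|x| <= 1) (fun x => 1 - `|x|) =
      graph_y (fun x => `|x| <= 1) (fun x => (1 - `|x|) / 2 + Num.max 0 ((1 - `|x|) / 2)).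
    by apply: graph_y_eq => x hx; rewrite max_r; lra.
  apply: (@stretch_y_isotopic _ _ _ 1).
  - by continuity.
  - by move=> y; have := normr_ge0 y; move: `|y| => u u0; apply/andP; split; minmax.
  - by move=> y hy; rewrite max_r; lra.
apply: (@ambient_isotopic_trans _ _ (in_S3 (graph_y (fun x => `|x| <= 1)
    (fun x => Num.min (height x) (2 * (1 - `|x|)))))).
  have -> : graph_y (fun x => `|x| <= 1) (fun x => Num.min (height x) (2 * (1 - `|x|))) =
      graph_y (fun x => `|x| <= 1) (fun x => 1 - `|x| +
        Num.max 0 (Num.min (height x) (2 * (1 - `|x|)) - (1 - `|x|))).
    apply: graph_y_eq => x hx; rewrite max_r ?subrKC // subr_ge0.
    have : 1 - `|x| <= height x.
      rewrite -height_norm; have x0 := normr_ge0 x.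
      apply: (heightP (_ : 0 <= `|x| <= 1) _).2.2; [by rewrite x0|lra|].
      by nra.
    by rewrite le_min => -> /=; lra.
  apply: (@stretch_y_isotopic _ _ _ 1).
  - by rewrite /height; continuity.
  - move=> x; have := height_ge0 x; have := height_le1 x; have := normr_ge0 x.
    by move: `|x| (height x) => u w u0 w1 w0; apply/andP; split; minmax.
  - move=> x hx; have := height_ge0 x; have := height_le1 x.
    by move: (height x) hx => w; move: `|x| => u u1 w1 w0; minmax.
have -> : graph_y (fun x => `|x| <= 1) (fun x => Num.min (height x) (2 * (1 - `|x|))) =
    graph_x (fun y => `|y| <= 1) (fun y => Num.min (height y) (1 - `|y| / 2)).
  apply/seteqP; split=> p [h e z0].
    have [+ _] := chord_sym (normr_ge0 p.1.1) (normr_ge0 p.1.2).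
    by rewrite !height_norm => /(_ (conj h e)) [].
  have [_ +] := chord_sym (normr_ge0 p.1.1) (normr_ge0 p.1.2).
  by rewrite !height_norm => /(_ (conj h e)) [].
have -> : unknot_image R = in_S3 (graph_x (fun y => `|y| <= 1) (fun y => Num.min (height y) (1
  - `|y| / 2) +
    (height y - Num.min (height y) (Num.max 0 (1 - `|y| / 2))))).
  congr in_S3; apply/seteqP; split=> -[[x y] z] /=.
    move=> [xy z0]; have y1 : `|y| <= 1.
      by rewrite -(expr_le1 (_ : (0 < 2)%N)) // real_normK ?num_real //; have := sqr_ge0 x;
        rewrite /circle /= in xy; lra.
    split=> //=; rewrite (@max_r _ _ 0); last lra.
    rewrite subrKC -height_norm.
    apply: (heightP (_ : 0 <= `|y| <= 1) _).1.2 => //; first by rewrite normr_ge0.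
    by rewrite !real_normK ?num_real // addrC.
  move=> [/= y1 + z0]; rewrite (@max_r _ _ 0); last lra.
  rewrite subrKC -height_norm => e; split=> //.
  have := (heightP (_ : 0 <= `|y| <= 1) (normr_ge0 x)).1.1; rewrite normr_ge0 => /(_ y1 e).
  by rewrite !real_normK ?num_real // addrC.
apply: (@stretch_x_isotopic _ _ _ 1).
- by rewrite /height; continuity.
- move=> y; have := height_ge0 y; have := height_le1 y; have := normr_ge0 y.
  by move: `|y| (height y) => u w u0 w1 w0; apply/andP; split; minmax.
- move=> y hy; have := height_ge0 y; have := height_le1 y.
  by move: (height y) hy => w; move: `|y| => u u1 w1 w0; minmax.
Qed.

End Round.

(** * Mosaics of size at most two, and the inequality *)

Section SmallMosaics.
Variable R : realType.

Lemma one_mosaic_empty (M : 'I_1 * 'I_1 -> tile) : ~ knot_mosaic R M.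
Proof.
move=> [_ nb [[[p [s t]] st] _]]; have [cs _] := arc_connection st.
have all_eq (q q' : 'I_1 * 'I_1) : q = q' by case: q q' => [a b] [c d]; rewrite !(ord1 _).
by move: (cs); apply/negP; apply: nb => q u; rewrite (all_eq q p) eqxx.
Qed.

(** All four tiles are corner tiles, and each forces its neighbours to be nonempty. *)
Lemma two_mosaic_tiles Mn : planar_connected 0 Mn ->
  (exists i j s t, [/\ (i < 2)%N, (j < 2)%N & (s, t) \in tile_arcs (Mn i j)]) ->
  forall a b, Mn (rim 0 a) (rim 0 b) = tile_corner a b.
Proof.
move=> PC [i [j [s [t [hi hj st]]]]].
pose c a b := is_connection (Mn (rim 0 a) (rim 0 b)) (sideY (~~ b)).
have rm d : (rim 0 d <= 1)%N by case: d.
have T a b : Mn (rim 0 a) (rim 0 b) = if c a b then tile_corner a b else T0.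
  by rewrite {1}(ring_tile_corner (boundaryX PC a (rm b)) (boundaryY PC b (rm a))).
have sym a b : c a b = is_connection (Mn (rim 0 a) (rim 0 b)) (sideX (~~ a)).
  by rewrite /c (corner_tile_sym (boundaryX PC a (rm b)) (boundaryY PC b (rm a))).
have cU a : c a false = c a true by rewrite /c (connected_U PC) //.
have cR b : c false b = c true b by rewrite !sym (connected_R PC).
suff [a [b cab]] : exists a b, c a b.
  have E a' b' : c a' b' = c true true by case: b'; rewrite ?cU; case: a'; rewrite ?cR.
  by move=> a' b'; rewrite T E -(E a b) cab.
have [a ia] : exists a, i = rim 0 a by case: i hi {st} => [|[|//]] _; [exists false|exists true].
have [b jb] : exists b, j = rim 0 b by case: j hj {st} => [|[|//]] _; [exists false|exists true].
exists a, b; apply: contraPT st => /negbTE cab; by rewrite ia jb T cab.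
Qed.

Lemma corner_arcs_diamond : \bigcup_(ab : bool * bool) corner_arc (0 : R) ab.1 ab.2 = @diamond R.
Proof.
apply/seteqP; split=> [p [[a b] _ [e /itv01P/andP[e0 e1] <-]]|[[x y] z] [/= xy ->]].
  by split=> //=; rewrite /wall /outward; case: a b => -[]; minmax.
exists (0 <= x, 0 <= y) => //; exists `|y|.
  by apply/itv01P; have := normr_ge0 x; have := normr_ge0 y => ? ?; apply/andP; split; lra.
by move: xy; rewrite /wall /outward /=; case: (ger0P x) => x0; case: (ger0P y) => y0 xy;
  congr (_, _, _); lra.
Qed.

Lemma two_mosaic_unknot (M : 'I_2 * 'I_2 -> tile) : knot_mosaic R M ->
  ambient_isotopic (in_S3 (mosaic_set (@planar_square R 2) M)) (unknot_image R).
Proof.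
move=> [sc nb [[[[i j] [s t]] st] _]].
have PC := planar_connectedP sc nb.
have tiles := two_mosaic_tiles PC _.
have {}tiles a b : M (inord (rim 0 a), inord (rim 0 b)) = tile_corner a b.
  apply: tiles; exists i, j, s, t; split=> //; by rewrite !inord_val.
apply: ambient_isotopic_trans (translate_isotopic (-1, -1, 0) _) _.
suff -> : (fun p => p + (-1, -1, 0)) @` mosaic_set (@planar_square R 2) M = @diamond R.
  exact: diamond_unknot.
rewrite -corner_arcs_diamond mosaic_setE image_bigcup.
have E a b : (fun p => p + (-1, -1, 0)) @` cell (@planar_square R 2 (inord (rim 0 a), inord
  (rim 0 b)))
    (M (inord (rim 0 a), inord (rim 0 b))) = corner_arc 0 a b.
  rewrite cell_shift tiles -cell_corner_arc; congr cell.
  rewrite /shift_square /planar_square /flat_square /=; congr Square.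
  have inK c : nat_of_ord (inord (rim 0 c) : 'I_2) = rim 0 c by rewrite inordK //; case: c.
  rewrite !inK.
  rewrite -[LHS]/(_ + -1, _ + -1, 0 + 0); case: (a); case: (b); rewrite /beyond /=;
    congr (_, _, _); lra.
apply/seteqP; split=> p.
  move=> [[k l] _].
  have rimE (q : 'I_2) : exists a, q = inord (rim 0 a).
    case: q => -[|[|//]] hk; [exists false|exists true]; apply/ord_inj; rewrite inordK //.
  have [a ->] := rimE k; have [b ->] := rimE l.
  by rewrite E => hp; exists (a, b).
by move=> [[a b] _]; rewrite -E => hp; exists (inord (rim 0 a), inord (rim 0 b)).
Qed.

Lemma spherical_of_planar (K : knot R) n : has_mosaic K n.+3 -> has_spherical_mosaic K n.+1.
Proof.
move=> [_ [M [[sc nb cc] rep]]]; split=> //.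
have PC := planar_connectedP sc nb.
set Mn := fun i j => _ in PC.
have ME : M = @planar_tiles n.+1 Mn.
  by apply/funext => -[i j]; rewrite /planar_tiles /Mn /= !inord_val.
rewrite ME in cc rep.
exists (@cube_tiles n.+1 Mn); split; first split.
- exact: cube_suitably_connected PC _.
- exact: cube_single_closed_curve PC cc.
- exact: ambient_isotopic_trans rep (planar_cube_isotopic _ _ PC).
Qed.

Lemma nontrivial_mosaic_size (K : knot R) m : nontrivial K -> has_mosaic K m -> (3 <= m)%N.
Proof.
move=> nK [m1 [M [kM rep]]]; case: m m1 M kM rep => [|[|[|m]]] // _ M kM rep; exfalso.
  exact: one_mosaic_empty kM.
exact: nK (ambient_isotopic_trans rep (two_mosaic_unknot kM)).
Qed.

End SmallMosaics.

Theorem theorem1p1 (R : realType) (K : knot R) (m : nat)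
    (hK : nontrivial K) (hm : is_mosaic_number K m) :
  exists s : nat,
    is_spherical_mosaic_number K s /\ (s%:Z <= m%:Z - 2)%R.
Proof.
case: hm => hm _; have m3 := nontrivial_mosaic_size hK hm.
case: m m3 hm => [|[|[|m]]] // _ /spherical_of_planar hs.
pose P k := `[< has_spherical_mosaic K k >].
have exP : exists k, P k by exists m.+1; exact/asboolP.
case: (ex_minnP exP) => s /asboolP Ps smin.
exists s; split; first by split=> // k /asboolP; exact: smin.
have : (s <= m.+1)%N by apply: smin; exact/asboolP.
by lia.
Qed.
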